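(* Let $X$ be a nonempty Hausdorff compact space, let $\alpha:X\to X$ be a continuous mapping, and let $A:C(X)\to C(X)$ be a transfer operator for $(X,\alpha)$ with $t$-entropy $\tau$. For a nonnegative $\psi\in C(X)$ let $\ell(\psi)$ be the logarithm of the spectral radius of the operator $A\psi:f\mapsto A(\psi f)$ on $C(X)$. Then for every nonnegative function $\psi\in C(X)$ $$\ell(\psi)=\max_{\mu\in M_\alpha}\left(\int_X\ln\psi\,d\mu+\tau(\mu)\right).$$
   Context: $C(X)$ is the algebra of continuous real-valued functions on $X$ with the uniform norm; $\mathbf 1$ is the unit function. A linear operator $A:C(X)\to C(X)$ is a transfer operator for $(X,\alpha)$ if it is positive (maps nonnegative functions to nonnegative functions) and satisfies $A\bigl((f\circ\alpha)\,g\bigr)=f\,Ag$ for all $f,g\in C(X)$. Thus $\ell(\psi)=\lim_{n\to\infty}\frac1n\ln\|(A\psi)^n\|\in[-\infty,\infty)$, with $\ln0=-\infty$; the integral $\int_X\ln\psi\,d\mu$ takes values in $[-\infty,\infty)$. $M$ is the set of all positive linear functionals $\mu$ on $C(X)$ with $\mu(\mathbf 1)=1$ (identified with regular Borel probability measures on $X$); $M_\alpha$ is the set of $\mu\in M$ with $\mu(f\circ\alpha)=\mu(f)$ for all $f\in C(X)$. A partition of unity in $C(X)$ is a finite set $D=\{g_1,\dots,g_k\}$ of nonnegative functions in $C(X)$ with $g_1+\dots+g_k\equiv 1$. The $t$-entropy is the functional $\tau$ on $M_\alpha$ given by $$\tau(\mu):=\inf_{n\in\mathbb N}\frac{\tau_n(\mu)}{n},\qquad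 \tau_n(\mu):=\inf_D\tau_n(\mu,D),\qquad \tau_n(\mu,D):=\sup_{m\in M}\sum_{g\in D}\mu(g)\ln\frac{m(A^ng)}{\mu(g)},$$ where the infimum is over all partitions of unity $D$ in $C(X)$; a summand with $\mu(g)=0$ is set to be zero regardless of $m(A^ng)$; and if for some $g\in D$ one has $A^ng\equiv0$ and $\mu(g)>0$, then $\tau(\mu)=-\infty$ (consistently with $\ln0=-\infty$). *)

(* Defs.v *)
From HB Require Import structures.
From mathcomp Require Import all_boot all_order all_algebra finmap.
From mathcomp Require Import all_classical all_reals all_analysis.

Set Implicit Arguments.
Unset Strict Implicit.
Unset Printing Implicit Defensive.

Import Order.TTheory GRing.Theory Num.Theory.
Import numFieldNormedType.Exports.

Local Open Scope classical_set_scope.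
Local Open Scope ring_scope.

(* C(X) is [continuousType X R]. The instances below make it a subalgebra of
   X -> R, so that 0, 1, f + g, f * g, a *: f are the pointwise operations. *)
Section continuous_algebra.
Context (X : topologicalType) (R : realType).

Definition ctsfun : {pred X -> R} := mem [set f | continuous f].

Section Sub.
Context (f : X -> R) (fP : f \in ctsfun).
#[local] HB.instance Definition _ := @isContinuous.Build X R f (set_mem fP).
Definition ctsfun_Sub : continuousType X R := f.
End Sub.

Lemma ctsfun_rect (K : continuousType X R -> Type) :
  (forall f (Pf : f \in ctsfun), K (ctsfun_Sub Pf)) -> forall u, K u.
Proof.
move=> Ksub [f [[Pf1]]].
have Pf : f \in ctsfun by rewrite inE.
have -> : Pf1 = set_mem Pf by exact: Prop_irrelevance.
exact: Ksub.
Qed.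

Lemma ctsfun_valP f (Pf : f \in ctsfun) : ctsfun_Sub Pf = f :> (X -> R).
Proof. by []. Qed.

HB.instance Definition _ :=
  isSub.Build _ _ (continuousType X R) ctsfun_rect ctsfun_valP.

Lemma ctsfun_subring_closed : subring_closed ctsfun.
Proof.
split=> [|f g|f g]; rewrite !inE/=.
- exact: (@cts_fun _ _ (cst (1 : R))).
- by move=> cf cg x; apply: cvgB; [exact: cf|exact: cg].
- by move=> cf cg x; apply: cvgM; [exact: cf|exact: cg].
Qed.

HB.instance Definition _ :=
  GRing.isSubringClosed.Build _ ctsfun ctsfun_subring_closed.

HB.instance Definition _ := GRing.SubChoice_isSubComPzRing.Build _ _
  (continuousType X R) (subringClosedP _).

Lemma ctsfun_scaler_closed : scaler_closed ctsfun.
Proof.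
move=> a f; rewrite !inE/= => cf x.
by apply: cvgM; [exact: cvg_cst|exact: cf].
Qed.

HB.instance Definition _ :=
  GRing.isScaleClosed.Build _ _ ctsfun ctsfun_scaler_closed.

HB.instance Definition _ :=
  [SubZmodule_isSubLmodule of continuousType X R by <:].

End continuous_algebra.

Section operators.
Context (X : topologicalType) (R : realType).
Local Notation C := (continuousType X R).

Definition nonneg (f : C) : Prop := forall x, 0 <= f x.

Definition unif_norm (f : C) : R := sup (range (fun x => `|f x|)).

Definition op_norm (T : C -> C) : \bar R :=
  ereal_sup [set (unif_norm (T f))%:E | f in [set f | unif_norm f <= 1]].

Definition is_transfer_operator (alpha : continuousType X X)
    (A : {linear C -> C}) : Prop :=
  (forall f, nonneg f -> nonneg (A f)) /\
  (forall f g : C, A ((f \o alpha : C) * g) = f * A g).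

Definition weighted (A : C -> C) (psi : C) : C -> C := fun f => A (psi * f).

(* Gelfand's formula for the logarithm of the spectral radius; [lne 0 = -oo]. *)
Definition log_spectral_radius (T : C -> C) : \bar R :=
  limn (fun n => ((n%:R^-1 : R)%:E * lne (op_norm (iter n T)))%E).

End operators.

Section functionals.
Context (X : topologicalType) (R : realType).
Local Notation C := (continuousType X R).

Definition states : set {scalar C} :=
  [set mu | (forall f : C, nonneg f -> 0 <= mu f) /\ mu 1 = 1].

Definition invariant_states (alpha : continuousType X X) : set {scalar C} :=
  [set mu | states mu /\ forall f : C, mu (f \o alpha : C) = mu f].

Definition partition_of_unity (D : {fset C}) : Prop :=
  (forall g : C, g \in D -> nonneg g) /\ \sum_(g <- D) g = 1.

Section t_entropy.
Variable A : C -> C.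
Local Open Scope ereal_scope.

(* As [lne 0 = -oo], every summand with mu g > 0 and m (A^n g) = 0 makes the
   sum -oo; no summand is +oo. *)
Definition tau_part (n : nat) (mu : {scalar C}) (D : {fset C}) : \bar R :=
  ereal_sup [set \sum_(g <- D)
      (if mu g == 0%R then 0 else (mu g)%:E * lne (m (iter n A g) / mu g)%:E)
    | m in states].

Definition tau_n (n : nat) (mu : {scalar C}) : \bar R :=
  ereal_inf [set tau_part n mu D | D in partition_of_unity].

Definition t_entropy (mu : {scalar C}) : \bar R :=
  ereal_inf [set (n%:R^-1 : R)%:E * tau_n n mu | n in [set n | (0 < n)%N]].

End t_entropy.
End functionals.

Section representing_measure.
Context (X : ptopologicalType) (R : realType).
Local Notation C := (continuousType X R).
Local Notation borel := (g_sigma_algebraType (@open X)).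
Local Open Scope ereal_scope.

Definition regular_measure (P : {measure set borel -> \bar R}) : Prop :=
  forall B : set borel, measurable B ->
    P B = ereal_inf [set P U | U in [set U : set X | open U /\ B `<=` U]] /\
    P B = ereal_sup [set P K | K in [set K : set X | compact K /\ K `<=` B]].

Definition represents (P : probability borel R) (mu : {scalar C}) : Prop :=
  forall f : C, (mu f)%:E = \int[P]_x (f x)%:E.

(* The measure identified with mu by the Riesz-Markov theorem: when X is compact
   Hausdorff and mu is a state, exactly one P satisfies the predicate. *)
Definition riesz_measure (mu : {scalar C}) : probability borel R :=
  get [set P : probability borel R | regular_measure P /\ represents P mu].

Definition integral_ln (psi : C) (mu : {scalar C}) : \bar R :=
  \int[riesz_measure mu]_x lne (psi x)%:E.

End representing_measure.

(* Main.v *)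
Require Import Defs.
From HB Require Import structures.
From mathcomp Require Import all_boot all_order all_algebra finmap.
From mathcomp Require Import all_classical all_reals all_analysis.
From mathcomp Require Import measurable_realfun zify ring lra.

(* With psi_n = \prod_(k < n) (psi o alpha^k) one has
   (A psi)^n f = A^n (psi_n f), so by Fekete's lemma l(psi) is the infimum over
   n > 0 of ln |A^n psi_n| / n.

   For the inequality l(psi) >= mu(ln psi) + tau(mu), take a partition of unity
   on whose members ln phi is nearly constant; Jensen's inequality for ln then
   gives mu(ln phi) + tau_n(mu) <= ln |A^n phi| for every phi > 0, in
   particular for phi = (psi + d)_n, and d is sent to 0.

   For attainment, let x_n be a maximum point of A^n psi_n and rho_n the state
   f |-> A^n (psi_n f)(x_n) / A^n psi_n (x_n).  An ultralimit mu of the states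
   f |-> rho_n(\sum_(k < n) f o alpha^k) / n is invariant, and it satisfies
   N (l(psi) - mu(ln (psi + d))) + mu(ln Psi) <= ln |A^N Psi| for all Psi > 0:
   test the convexity of exp on phi = (ln Psi) / N and compare
   e^(\sum_(k < n) phi o alpha^k) with products of Psi along the N residue
   classes of k, by the AM-GM inequality.  Given a partition D, apply this to
   Psi = \sum_(g in D) b_g g with b_g = mu(g) / m(A^N g), where the state m
   maximizes \sum_(g in D) mu(g) ln m(A^N g): optimality of m bounds |A^N Psi|
   by 1 (up to a regularization that keeps every b_g finite and positive), which
   yields tau_N(mu, D) >= N (l(psi) - mu(ln (psi + d))).

   The integral of ln psi is reached through the Riesz-Markov theorem, the
   measure being the Caratheodory restriction of the outer measure generated by
   U |-> sup {mu f : 0 <= f <= 1, f = 0 off U} on open sets. *)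

Set Implicit Arguments.
Unset Strict Implicit.
Unset Printing Implicit Defensive.

Import Order.TTheory GRing.Theory Num.Theory.
Import numFieldNormedType.Exports.

Local Open Scope classical_set_scope.
Local Open Scope ring_scope.

(** * Positive functionals and operators on C(X) *)

Section continuous_functions.
Context (X : topologicalType) (R : realType).
Local Notation C := (continuousType X R).

Definition cfun (f : X -> R) (cf : continuous f) : C := ctsfun_Sub (mem_set cf).

Lemma cts_ext (f g : C) : f =1 g -> f = g.
Proof. by move=> fg; apply: val_inj; apply/funext. Qed.

Lemma ctsDE (f g : C) x : (f + g) x = f x + g x. Proof. by []. Qed.
Lemma ctsNE (f : C) x : (- f) x = - f x. Proof. by []. Qed.
Lemma ctsME (f g : C) x : (f * g) x = f x * g x. Proof. by []. Qed.
Lemma ctsZE a (f : C) x : (a *: f) x = a * f x. Proof. by []. Qed.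
Lemma cts0E x : (0 : C) x = 0. Proof. by []. Qed.
Lemma cts1E x : (1 : C) x = 1. Proof. by []. Qed.
Lemma cts_compE (f : C) (g : continuousType X X) x : (f \o g : C) x = f (g x).
Proof. by []. Qed.
Definition ctsE := (ctsDE, ctsNE, ctsME, ctsZE, cts0E, cts1E, cts_compE).

Lemma cts_sumE I (r : seq I) (P : pred I) (F : I -> C) x :
  (\sum_(i <- r | P i) F i) x = \sum_(i <- r | P i) F i x.
Proof. exact: (big_morph (fun f : C => f x)). Qed.

Lemma cts_prodE I (r : seq I) (P : pred I) (F : I -> C) x :
  (\prod_(i <- r | P i) F i) x = \prod_(i <- r | P i) F i x.
Proof. exact: (big_morph (fun f : C => f x)). Qed.

Lemma cln_subproof (f : C) (f0 : forall x, 0 < f x) :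
  continuous (fun x => ln (f x)).
Proof.
move=> x; suff : {for x, continuous (@ln R \o f)} by [].
by apply: continuous_comp; [exact: cts_fun|exact: continuous_ln].
Qed.

Definition cln (f : C) (f0 : forall x, 0 < f x) : C := cfun (cln_subproof f0).

Lemma cexp_subproof (f : C) : continuous (fun x => expR (f x)).
Proof.
move=> x; suff : {for x, continuous (@expR R \o f)} by [].
by apply: continuous_comp; [exact: cts_fun|exact: continuous_expR].
Qed.

Definition cexp (f : C) : C := cfun (@cexp_subproof f).

Lemma cmax_subproof (f g : C) : continuous (fun x => Num.max (f x) (g x)).
Proof. by move=> x; apply: continuous_max; exact: cts_fun. Qed.

Definition cmax (f g : C) : C := cfun (@cmax_subproof f g).

Lemma cmin_subproof (f g : C) : continuous (fun x => Num.min (f x) (g x)).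
Proof. by move=> x; apply: continuous_min; exact: cts_fun. Qed.

Definition cmin (f g : C) : C := cfun (@cmin_subproof f g).

Definition mkscalar (F : C -> R) (lF : scalar F) : {scalar C} :=
  HB.pack F (GRing.isLinear.Build R C R _ F lF).

Definition dirac_state (x : X) : {scalar C} :=
  @mkscalar (fun f => f x) (fun _ _ _ => erefl).

Lemma dirac_stateP x : states (dirac_state x).
Proof. by split=> // f /(_ x). Qed.

End continuous_functions.

(** * Positive functionals and positive operators on a compact space *)

Section positive_maps.
Context (R : realType) (X : ptopologicalType) (compX : compact [set: X]).
Local Notation C := (continuousType X R).
Implicit Types (f g : C).

Lemma ubound_norm f : has_sup (range (fun x => `|f x|)).
Proof.
split; first by exists `|f point|, point.
have cf : {within [set: X], continuous (fun x => `|f x|)}.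
  apply: continuous_subspaceT => x.
  by apply: continuous_comp; [exact: cts_fun|exact: norm_continuous].
have [c _ cmax] := compact_EVT_max (ex_intro _ point I) compX cf.
by exists `|f c| => _ [x _ <-]; apply: cmax; rewrite inE.
Qed.

Lemma le_unif_norm f x : `|f x| <= unif_norm f.
Proof. by apply: ub_le_sup; [have [] := ubound_norm f|exists x]. Qed.

Lemma unif_norm_le f c : (forall x, `|f x| <= c) -> unif_norm f <= c.
Proof.
move=> fc; apply: ge_sup; first by have [] := ubound_norm f.
by move=> _ [x _ <-].
Qed.

Lemma unif_norm_ge0 f : 0 <= unif_norm f.
Proof. exact: le_trans (normr_ge0 _) (le_unif_norm f point). Qed.

Lemma unif_norm_attained f : nonneg f -> exists x, f x = unif_norm f.
Proof.
move=> f0.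
have cf : {within [set: X], continuous (f : X -> R)}.
  by apply: continuous_subspaceT; exact: cts_fun.
have [c _ cmax] := compact_EVT_max (ex_intro _ point I) compX cf.
exists c; apply/eqP; rewrite eq_le; apply/andP; split.
  by rewrite -[f c]ger0_norm ?le_unif_norm.
by apply: unif_norm_le => x; rewrite ger0_norm// cmax// inE.
Qed.

Section state.
Variables (mu : {scalar C}) (smu : states mu).

Lemma state_ge0 f : nonneg f -> 0 <= mu f.
Proof. by case: smu => + _; apply. Qed.

Lemma state1 : mu 1 = 1. Proof. by case: smu. Qed.

Lemma state_le f g : (forall x, f x <= g x) -> mu f <= mu g.
Proof.
move=> fg; rewrite -subr_ge0 -raddfB; apply: state_ge0 => x.
by rewrite !ctsE subr_ge0.
Qed.

Lemma stateZ (a : R) f : mu (a *: f) = a * mu f.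
Proof. by rewrite linearZ. Qed.

Lemma stateD f g : mu (f + g) = mu f + mu g.
Proof. by rewrite raddfD. Qed.

Lemma stateN f : mu (- f) = - mu f.
Proof. by rewrite raddfN. Qed.

Lemma stateB f g : mu (f - g) = mu f - mu g.
Proof. by rewrite raddfB. Qed.

Lemma state_sum (I : Type) (r : seq I) (p : pred I) (F : I -> C) :
  mu (\sum_(i <- r | p i) F i) = \sum_(i <- r | p i) mu (F i).
Proof. exact: raddf_sum. Qed.

Lemma state_cst (a : R) : mu (a *: (1 : C)) = a.
Proof. by rewrite stateZ state1 mulr1. Qed.

Lemma state_le_cst f c : (forall x, f x <= c) -> mu f <= c.
Proof.
move=> fc; rewrite -[leRHS]state_cst; apply: state_le => x.
by rewrite !ctsE mulr1.
Qed.

Lemma state_ge_cst f c : (forall x, c <= f x) -> c <= mu f.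
Proof.
move=> fc; rewrite -[leLHS]state_cst; apply: state_le => x.
by rewrite !ctsE mulr1.
Qed.

Lemma state_norm f : `|mu f| <= unif_norm f.
Proof.
rewrite ler_norml; apply/andP; split.
  apply: (@state_ge_cst f) => x; have := le_unif_norm f x.
  by rewrite ler_norml => /andP[].
by apply: (@state_le_cst f) => x; apply: le_trans (le_unif_norm f x);
  apply: ler_norm.
Qed.

End state.

Section positive_operator.
Variables (B : {linear C -> C}) (Bpos : forall f, nonneg f -> nonneg (B f)).

Lemma pos_le f g : (forall x, f x <= g x) -> forall x, B f x <= B g x.
Proof.
move=> fg x; rewrite -subr_ge0.
have -> : B g x - B f x = B (g - f) x by rewrite raddfB.
by apply: Bpos => y; rewrite !ctsE subr_ge0.
Qed.

Lemma pos_norm f x : `|B f x| <= unif_norm f * B 1 x.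
Proof.
have -> : unif_norm f * B 1 x = B (unif_norm f *: (1 : C)) x by rewrite linearZ.
rewrite ler_norml; apply/andP; split.
  have -> : - B (unif_norm f *: (1 : C)) x = B (- (unif_norm f *: (1 : C))) x.
    by rewrite raddfN.
  apply: pos_le => y; have := le_unif_norm f y.
  by rewrite !ctsE mulr1 ler_norml => /andP[].
apply: pos_le => y; apply: le_trans (ler_norm _) _.
by rewrite !ctsE mulr1; exact: le_unif_norm.
Qed.

Lemma unif_norm_pos_le f : unif_norm (B f) <= unif_norm f * unif_norm (B 1).
Proof.
apply: unif_norm_le => x; apply: le_trans (pos_norm f x) _.
rewrite ler_wpM2l ?unif_norm_ge0//.
exact: le_trans (ler_norm _) (le_unif_norm _ x).
Qed.

(** The pointwise bound |B f| <= |f| B 1 shows that the unit function attains the supremum over the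
    unit ball. *)
Lemma op_normE : op_norm B = (unif_norm (B 1))%:E.
Proof.
apply/eqP; rewrite eq_le; apply/andP; split.
  apply: ge_ereal_sup => _ [f f1 <-]; rewrite lee_fin.
  apply: le_trans (unif_norm_pos_le f) _.
  by rewrite ler_piMl// unif_norm_ge0.
apply: ereal_sup_ubound; exists 1 => //.
by apply: unif_norm_le => x; rewrite normr1.
Qed.

End positive_operator.

End positive_maps.

(** * Weak-star compactness of the set of states *)

Section ultralimits.
Context (R : realType).

(** Limits along a free ultrafilter replace convergent subsequences of states, which may fail to
    exist when C(X) is not separable. *)
Lemma ultrafilter_ex : exists2 U : set_system nat, UltraFilter U & \oo `<=` U.
Proof. by have [U [? ?]] := ultraFilterLemma eventually_filter; exists U. Qed.

(** The image filter lives on a compact segment, so it has a cluster point, and an ultrafilter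
    converges to its cluster points. *)
Lemma bounded_ultra_cvg T (U : set_system T) (UU : UltraFilter U)
  (u : T -> R) (M : R) : (forall t, `|u t| <= M) -> cvg (u t @[t --> U]).
Proof.
move=> uM.
have uMM : (u @ U) `[- M, M]%classic.
  by apply: nearW => t; rewrite /= in_itv/= -ler_norml.
have [p [_ clp]] := @segment_compact R (- M) M (u @ U) _ uMM.
apply/cvg_ex; exists p => V Vp.
case: (in_ultra_setVsetC (u @^-1` V) UU) => // UnV.
by have [y []] := clp (~` V) V UnV Vp.
Qed.

Context (X : ptopologicalType) (compX : compact [set: X]).
Local Notation C := (continuousType X R).

(** States are bounded by the norm of their argument, so their values at each [f] converge along
    [U]; linearity, positivity and normalization are closed conditions. *)
Lemma state_ultra_cvg T (U : set_system T) (UU : UltraFilter U)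
    (m_ : T -> {scalar C}) : (forall t, states (m_ t)) ->
  exists2 m : {scalar C}, states m &
    forall f : C, m_ t f @[t --> U] --> m f.
Proof.
move=> sm_; pose F (f : C) := lim (m_ t f @[t --> U]).
have FP (f : C) : m_ t f @[t --> U] --> F f.
  by apply: (bounded_ultra_cvg UU) => t; exact: (state_norm compX).
have lF : scalar F.
  move=> a f g; apply: (cvg_unique (@norm_hausdorff R R) (FP (a *: f + g))).
  have -> : (fun t => m_ t (a *: f + g)) = (fun t => a * m_ t f + m_ t g).
    by apply/funext => t; rewrite -stateZ -raddfD.
  by apply: cvgD; [apply: cvgMl_tmp; exact: FP|exact: FP].
exists (mkscalar lF) => //; split => [f f0|]; rewrite /mkscalar/=.
  apply: limr_ge; first exact: FP.
  by apply: nearW => t; exact: (state_ge0 (sm_ t)).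
apply: (cvg_unique (@norm_hausdorff R R) (FP 1)).
have -> : (fun t => m_ t 1) = (fun=> 1).
  by apply/funext => t; rewrite (state1 (sm_ t)).
exact: cvg_cst.
Qed.

End ultralimits.

(** * The Riesz-Markov theorem *)

Section compact_hausdorff.
Context (X : topologicalType).

(** If [P setT] failed, the sets whose complement satisfies [P] would form a proper filter; a
    neighbourhood satisfying [P] of one of its cluster points is contradictory. *)
Lemma compact_set_ind (P : set X -> Prop) : compact [set: X] ->
  P set0 -> (forall S T, S `<=` T -> P T -> P S) ->
  (forall S T, P S -> P T -> P (S `|` T)) ->
  (forall x : X, exists2 V, nbhs x V & P V) -> P setT.
Proof.
move=> compX P0 PS PU Pnbhs; apply: contrapT => nPT.
pose F : set_system X := [set S | P (~` S)].
have FF : ProperFilter F.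
  split; first by rewrite /F /= setC0.
  split; rewrite /F.
  - by rewrite /= setCT.
  - by move=> S T FS FT; have := PU _ _ FS FT; rewrite -setCI.
  - by move=> S T ST; apply: PS; exact: subsetC.
have [p [_ clp]] := compX F FF filterT.
have [V Vp PV] := Pnbhs p.
have FV : F (~` V) by rewrite /F /= setCK.
by have [q []] := clp _ _ FV Vp.
Qed.

Context (R : realType).
Local Notation C := (continuousType X R).

(** The test functions of the open set [U]. Vanishing off [U] is a weaker demand than compact
    support inside [U]. *)
Definition bump (U : set X) (f : C) :=
  (forall x, 0 <= f x <= 1) /\ forall x, ~ U x -> f x = 0.

Lemma bump0 U : bump U 0.
Proof. by split=> // x; rewrite !ctsE lexx ler01. Qed.

Lemma bump_max U f g : bump U f -> bump U g -> bump U (cmax f g).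
Proof.
move=> [f01 f0] [g01 g0]; split=> x => [|Ux]; last first.
  by rewrite /cmax /= f0// g0// maxxx.
rewrite /= le_max ge_max.
by have /andP[-> ->] := f01 x; have /andP[_ ->] := g01 x.
Qed.

Hypotheses (hausX : hausdorff_space X) (compX : compact [set: X]).

Lemma bump_at (U : set X) x : open U -> U x ->
  exists2 h : C, bump U h & h x = 1.
Proof.
move=> oU Ux.
have nX := compact_normal hausX compX.
have /(@normal_separatorP R) sep := nX.
have clx : closed [set x] by exact/accessible_closed_set1/hausdorff_accessible.
have clU : closed (~` U) by exact: open_closedC.
have us : uniform_separator (~` U) [set x].
  apply: sep clU clx _; apply/seteqP; split => // y [/= nUy yx].
  by apply: nUy; rewrite yx.
have cf := @Urysohn_continuous X R (~` U) [set x].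
exists (cfun cf); last first.
  by apply: (Urysohn_sub1 us); exists x.
split=> y => [|Uy].
  have /Urysohn_range : range (@Urysohn X R (~` U) [set x])
    (Urysohn (~` U) [set x] y) by exists y.
  by rewrite /= in_itv.
by apply: (Urysohn_sub0 us); exists y.
Qed.

Lemma cts_open_gt (f : C) a : open [set x | a < f x].
Proof.
apply: (@open_comp _ _ f [set r | a < r]); last exact: open_gt.
by move=> x _; exact: cts_fun.
Qed.

Lemma cts_open_lt (f : C) a : open [set x | f x < a].
Proof.
apply: (@open_comp _ _ f [set r | r < a]); last exact: open_lt.
by move=> x _; exact: cts_fun.
Qed.

(** Compactness turns the countable union into a finite sum: this is countable subadditivity of the
    content at the level of functions. *)
Lemma bump_bigcup_approx (U : nat -> set X) (f : C) (e : R) :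
  (forall i, open (U i)) -> bump (\bigcup_i U i) f -> 0 < e ->
  exists n (g : nat -> C), (forall i, bump (U i) (g i)) /\
    forall x, f x - e <= \sum_(i < n) g i x.
Proof.
move=> oU [f01 f0] e0.
pose P S := exists n (g : nat -> C), (forall i, bump (U i) (g i)) /\
    forall x, S x -> f x - e <= \sum_(i < n) g i x.
suff [n [g [bg H]]] : P setT by exists n, g; split => // x; exact: H.
apply: (compact_set_ind compX).
- by exists 0, (fun=> 0); split => // i; exact: bump0.
- move=> S T ST [n [g [bg H]]]; exists n, g; split => // x /ST; exact: H.
(* Pointwise maxima dominate both families, and nonnegativity lets either sum be extended to [n + m]
   terms. *)
- move=> S T [n [g [bg Hg]]] [m [h [bh Hh]]].
  exists (n + m)%N, (fun i => cmax (g i) (h i)).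
  split=> [i|x]; first exact: bump_max.
  have max0 i : 0 <= cmax (g i) (h i) x.
    by have [/(_ x)/andP[]] := bump_max (bg i) (bh i).
  have sum_le k l : (k <= l)%N -> \sum_(i < k) cmax (g i) (h i) x
      <= \sum_(i < l) cmax (g i) (h i) x.
    move=> kl; rewrite -(subnKC kl) big_split_ord/= lerDl.
    by apply: sumr_ge0 => i _; exact: max0.
  move=> [/Hg|/Hh] Hx; apply: (le_trans Hx).
    apply: le_trans (sum_le _ _ (leq_addr m n)).
    by apply: ler_sum => i _; rewrite le_max lexx.
  apply: le_trans (sum_le _ _ (leq_addl n m)).
  by apply: ler_sum => i _; rewrite le_max lexx orbT.
(* Where [f < e] the empty sum suffices. Otherwise [x] lies in some [U i], and the Urysohn function
   at [x] exceeds [1 - e], hence [f - e], near [x]. *)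
- move=> x; have [fxe|fxe] := ltP (f x) e.
    exists [set y | f y < e];
      first exact: open_nbhs_nbhs (conj (@cts_open_lt _ _) _).
    exists 0, (fun=> 0); split=> [i|y /= fye]; first exact: bump0.
    by rewrite big_ord0 subr_le0 ltW.
  have [i _ Uix] : (\bigcup_i U i) x.
    by apply: contrapT => /f0 fx0; move: fxe; rewrite fx0 leNgt e0.
  have [h bh hx1] := bump_at (oU i) Uix.
  exists [set y | 1 - e < h y].
    apply: open_nbhs_nbhs (conj (@cts_open_gt _ _) _) => /=.
    by rewrite hx1; lra.
  exists i.+1, (fun j => if j == i then h else 0); split.
    by move=> j; case: eqP => [->//|_]; exact: bump0.
  move=> y /= hy; rewrite big_ord_recr/= eqxx big1 ?add0r; last first.
    by move=> j _; rewrite ltn_eqF.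
  rewrite (le_trans _ (ltW hy))// lerD2r.
  by have /andP[] := f01 y.
Qed.

End compact_hausdorff.

(** * The outer measure of a state, its Borel restriction and regularity *)

Section riesz_outer_measure.
Context (R : realType) (X : ptopologicalType).
Hypotheses (hausX : hausdorff_space X) (compX : compact [set: X]).
Local Notation C := (continuousType X R).
Variables (mu : {scalar C}) (smu : states mu).
Local Open Scope ereal_scope.

Definition open_content (U : set X) : \bar R :=
  ereal_sup [set (mu f)%:E | f in bump U].

Definition riesz_outer (E : set X) : \bar R :=
  ereal_inf [set open_content U | U in [set U | open U /\ E `<=` U]].

Lemma open_content_ge0 U : 0 <= open_content U.
Proof.
apply: ereal_sup_ubound; exists 0%R; first exact: bump0.
by rewrite raddf0.
Qed.

Lemma open_content_le1 U : open_content U <= 1.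
Proof.
apply: ge_ereal_sup => _ [f [f01 _] <-]; rewrite lee_fin.
by apply: (state_le_cst smu) => x; have /andP[] := f01 x.
Qed.

Lemma open_content_fin U : open_content U \is a fin_num.
Proof.
rewrite ge0_fin_numE ?open_content_ge0//.
exact: le_lt_trans (open_content_le1 U) (ltry _).
Qed.

Lemma open_content_setT : open_content setT = 1.
Proof.
apply/eqP; rewrite eq_le open_content_le1/=.
apply: ereal_sup_ubound; exists 1%R; last by rewrite (state1 smu).
by split=> x => [|/(_ I)//]; rewrite !ctsE lexx ler01.
Qed.

Lemma bump_le_open_content U f : bump U f -> (mu f)%:E <= open_content U.
Proof. by move=> bf; apply: ereal_sup_ubound; exists f. Qed.

Lemma open_content_adherent U (e : R) : (0 < e)%R ->
  exists2 f, bump U f & open_content U < (mu f + e)%:E.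
Proof.
move=> e0; have [_ [f bf <-] H] := ub_ereal_sup_adherent e0 (open_content_fin
  U).
by exists f => //; rewrite EFinD; move: H; rewrite lteBlDr.
Qed.

Lemma open_content_mono U V : U `<=` V -> open_content U <= open_content V.
Proof.
move=> UV; apply: ge_ereal_sup => _ [f [f01 f0] <-].
apply: bump_le_open_content; split => // x nVx; apply: f0 => /UV.
exact: nVx.
Qed.

Lemma open_content_bigcup (U : nat -> set X) : (forall i, open (U i)) ->
  open_content (\bigcup_i U i) <= \sum_(i <oo) open_content (U i).
Proof.
move=> oU; apply/lee_addgt0Pr => e e0.
apply: ge_ereal_sup => _ [f bf <-].
have [n [g [bg H]]] := bump_bigcup_approx hausX compX oU bf e0.
apply: (@le_trans _ _ (\sum_(i < n) (mu (g i))%:E + e%:E)).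
  rewrite sumEFin -EFinD lee_fin -raddf_sum -lerBlDr.
  rewrite -[X in (_ - X)%R](state_cst smu e) -raddfB.
  apply: (state_le smu) => x; rewrite !ctsE mulr1 cts_sumE; exact: H.
rewrite leeD2r//; apply: (@le_trans _ _ (\sum_(i < n) open_content (U i))).
  by apply: lee_sum => i _; exact: bump_le_open_content.
rewrite -(big_mkord xpredT (fun i => open_content (U i))).
by apply: nneseries_lim_ge => k _ _; exact: open_content_ge0.
Qed.

Lemma riesz_outer_open U : open U -> riesz_outer U = open_content U.
Proof.
move=> oU; apply/eqP; rewrite eq_le; apply/andP; split.
  by apply: ereal_inf_lbound; exists U => //; split => // x.
by apply: le_ereal_inf_tmp => _ [V [oV UV] <-]; exact: open_content_mono.
Qed.

Lemma riesz_outer_ge0 E : 0 <= riesz_outer E.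
Proof. by apply: le_ereal_inf_tmp => _ [V _ <-]; exact: open_content_ge0. Qed.

Lemma riesz_outer_mono : {homo riesz_outer : A B / A `<=` B >-> A <= B}.
Proof.
move=> A B AB; apply: le_ereal_inf_tmp => _ [V [oV BV] <-].
by apply: ereal_inf_lbound; exists V => //; split => // x /AB /BV.
Qed.

Lemma riesz_outer_le1 E : riesz_outer E <= 1.
Proof.
rewrite -open_content_setT -(riesz_outer_open openT).
exact: riesz_outer_mono.
Qed.

Lemma riesz_outer_fin E : riesz_outer E \is a fin_num.
Proof.
rewrite ge0_fin_numE ?riesz_outer_ge0//.
exact: le_lt_trans (riesz_outer_le1 E) (ltry _).
Qed.

Lemma riesz_outer0 : riesz_outer set0 = 0.
Proof.
rewrite riesz_outer_open; last exact: open0.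
apply/eqP; rewrite eq_le open_content_ge0 andbT.
apply: ge_ereal_sup => _ [f [_ f0] <-].
suff -> : f = 0%R by rewrite raddf0.
by apply: cts_ext => x; exact: f0.
Qed.

Lemma riesz_outer_adherent E (e : R) : (0 < e)%R ->
  exists U, [/\ open U, E `<=` U & open_content U <= riesz_outer E + e%:E].
Proof.
move=> e0.
have [_ [U [oU EU] <-] H] := lb_ereal_inf_adherent e0 (riesz_outer_fin E).
by exists U; split => //; exact: ltW.
Qed.

Lemma riesz_outer_sigma_subadditive : sigma_subadditive riesz_outer.
Proof.
move=> A; apply/lee_addgt0Pr => e e0.
apply: le_trans (epsilon_trick _ _ (ltW e0)); last first.
  by move=> n; exact: riesz_outer_ge0.
have /choice[U UP] n : exists U, [/\ open U, A n `<=` U &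
    open_content U <= riesz_outer (A n) + (e / (2 ^ n.+1)%:R)%:E].
  by apply: riesz_outer_adherent; rewrite divr_gt0// ltr0n expn_gt0.
apply: (@le_trans _ _ (\sum_(i <oo) open_content (U i))).
  apply: le_trans (open_content_bigcup _); last by move=> i; case: (UP i).
  apply: ereal_inf_lbound; exists (\bigcup_i U i) => //; split.
    by apply: bigcup_open => i _; case: (UP i).
  by apply: subset_bigcup => i _; case: (UP i).
by apply: lee_nneseries => i _ => [_|]; [exact: open_content_ge0|case: (UP i)].
Qed.

HB.instance Definition _ := isOuterMeasure.Build R X riesz_outer
  riesz_outer0 riesz_outer_ge0 riesz_outer_mono riesz_outer_sigma_subadditive.

(** Take [f] nearly optimal for [V] inside [U], and [g] nearly optimal for the part [W] of [V] where
    [f < e / 3]; [W] covers [V] minus [U] because [f] vanishes there. Then [f + g <= 1 + e / 3], so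
    a rescaling of the sum is a bump on [V]. *)
Lemma open_content_split U V : open U -> open V ->
  open_content (V `&` U) + riesz_outer (V `&` ~` U) <= open_content V.
Proof.
move=> oU oV; apply/lee_addgt0Pr => e e0.
have e30 : (0 < e / 3)%R by rewrite divr_gt0.
have [f [f01 f0] Hf] := open_content_adherent (V `&` U) e30.
pose W := V `&` [set x | (f x < e / 3)%R].
have oW : open W by apply: openI => //; exact: cts_open_lt.
have [g [g01 g0] Hg] := open_content_adherent W e30.
have VUW : riesz_outer (V `&` ~` U) <= open_content W.
  apply: ereal_inf_lbound; exists W => //; split => // x [Vx nUx]; split => //=.
  by rewrite f0// => -[].
apply: (@le_trans _ _ ((mu f + e / 3)%:E + (mu g + e / 3)%:E)).
  by apply: leeD; [exact: ltW|exact: le_trans VUW (ltW Hg)].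
pose s : R := (1 + e / 3)%R.
have s0 : (0 < s)%R by rewrite /s; lra.
have bh : bump V (s^-1 *: (f + g))%R.
  split=> x; rewrite !ctsE.
    have /andP[fx0 fx1] := f01 x; have /andP[gx0 gx1] := g01 x.
    apply/andP; split.
      by apply: mulr_ge0; [rewrite invr_ge0 ltW|rewrite addr_ge0].
    rewrite mulrC ler_pdivrMr// mul1r /s.
    have [fe|fe] := ltP (f x) (e / 3)%R; first lra.
    rewrite g0; first lra.
    by move=> [_ /=]; rewrite ltNge fe.
  by move=> nVx; rewrite f0 ?g0 ?addr0 ?mulr0// => -[].
have := bump_le_open_content bh.
have Vfin := open_content_fin V.
have := open_content_le1 V.
rewrite -(fineK Vfin) -!EFinD !lee_fin => V1.
rewrite (stateZ mu) raddfD mulrC ler_pdivrMr// /s => H.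
(* Each of the two near-optima costs [e / 3], and so does the normalization by [s], the content
   being at most 1. *)
have : (fine (open_content V) * (e / 3) <= e / 3)%R.
  by rewrite ler_piMl// divr_ge0// ltW.
lra.
Qed.

Lemma open_caratheodory U : open U -> riesz_outer.-caratheodory U.
Proof.
move=> oU; apply: le_caratheodory_measurable => E.
apply: le_ereal_inf_tmp => _ [V [oV EV] <-].
apply: le_trans (open_content_split oU oV).
rewrite -riesz_outer_open; last exact: openI.
by apply: leeD; apply: riesz_outer_mono; exact: setSI.
Qed.

Local Notation borel := (g_sigma_algebraType (@open X)).

Lemma borel_caratheodory (B : set borel) :
  measurable B -> riesz_outer.-caratheodory B.
Proof.
apply: smallest_sub; last exact: open_caratheodory.
split.
- exact: caratheodory_measurable_set0.
- move=> A mA; rewrite setTD; exact: caratheodory_measurable_setC.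
- move=> A mA; exact: caratheodory_measurable_bigcup.
Qed.

Definition riesz_borel : set borel -> \bar R := riesz_outer.

Let riesz_borel0 : riesz_borel set0 = 0. Proof. exact: riesz_outer0. Qed.

Let riesz_borel_ge0 B : 0 <= riesz_borel B.
Proof. exact: riesz_outer_ge0. Qed.

Let riesz_borel_sigma_additive : semi_sigma_additive riesz_borel.
Proof.
move=> F mF tF mUF.
apply: (@caratheodory_measure_sigma_additive R X riesz_outer) => //.
- by move=> i; exact: borel_caratheodory.
- exact: borel_caratheodory.
Qed.

HB.instance Definition _ := isMeasure.Build _ _ _ riesz_borel
  riesz_borel0 riesz_borel_ge0 riesz_borel_sigma_additive.

Let riesz_borelT : riesz_borel setT = 1.
Proof.
by rewrite /riesz_borel riesz_outer_open ?open_content_setT//; exact: openT.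
Qed.

HB.instance Definition _ :=
  Measure_isProbability.Build _ _ _ riesz_borel riesz_borelT.

Definition riesz_probability : probability borel R := riesz_borel.

Lemma open_borel (U : set borel) : open (U : set X) -> measurable U.
Proof. by move=> oU; exact: sub_sigma_algebra. Qed.

(** Outer regularity is built into the outer measure. Inner regularity is outer regularity of the
    complement, since closed sets are compact. *)
Lemma riesz_probability_regular : regular_measure riesz_probability.
Proof.
have outer (B : set borel) : measurable B -> riesz_probability B =
    ereal_inf [set riesz_probability U | U in [set U : set X | open U /\ B `<=`
      U]].
  move=> mB; rewrite {1}/riesz_probability/= /riesz_borel /riesz_outer.
  congr ereal_inf; apply/seteqP; split => _ [U [oU BU] <-]; exists U => //.
    exact: riesz_outer_open.
  exact/esym/riesz_outer_open.
move=> B mB; split; first exact: outer.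
apply/eqP; rewrite eq_le; apply/andP; split; last first.
  apply: ge_ereal_sup => _ [K [cK KB] <-]; apply: le_measure => //;
    rewrite inE//.
  rewrite -[K]setCK; apply: measurableC; apply: open_borel.
  by apply: closed_openC; exact: compact_closed.
apply/lee_addgt0Pr => e e0.
have [U [oU BU HU]] := riesz_outer_adherent (~` B) e0.
rewrite -riesz_outer_open// in HU.
have mU : measurable (U : set borel) by exact: open_borel.
have {}HU : riesz_probability U <= riesz_probability (~` B) + e%:E by [].
rewrite probability_setC// in HU.
apply: (@le_trans _ _ (riesz_probability (~` (U : set borel)) + e%:E)).
  rewrite probability_setC//.
  have [b Eb] : exists b, riesz_probability B = b%:E.
    by exists (fine (riesz_probability B)); rewrite fineK// fin_num_measure.
  have [u Eu] : exists u, riesz_probability U = u%:E.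
    by exists (fine (riesz_probability U)); rewrite fineK// fin_num_measure.
  apply: (@le_trans _ _ b%:E); first by rewrite -Eb.
  by move: HU; rewrite Eb Eu -!EFinB -!EFinD !lee_fin => HU; lra.
rewrite leeD2r//; apply: ereal_sup_ubound; exists (~` U) => //; split.
  apply: (subclosed_compact _ compX) => //; exact: open_closedC.
by move=> x nUx; apply: contrapT => /BU.
Qed.

End riesz_outer_measure.

(** * Measurability and integrability of continuous functions *)

Section borel_integral.
Context (R : realType) (X : ptopologicalType).
Hypothesis (compX : compact [set: X]).
Local Notation C := (continuousType X R).
Local Notation borel := (g_sigma_algebraType (@open X)).

Lemma cts_measurable (f : C) : measurable_fun setT (f : borel -> R).
Proof.
apply: (measurability _ (RGenOpens.measurableE R)).
move=> _ [_ [a [b ->] <-]]; rewrite setTI; apply: open_borel.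
apply: open_comp; last exact: interval_open.
by move=> x _; exact: cts_fun.
Qed.

Variable P : probability borel R.

Lemma cts_integrable (f : C) : P.-integrable setT (EFin \o (f : borel -> R)).
Proof.
apply: measurable_bounded_integrable => //.
- by have PT : (P setT < +oo)%E by rewrite probability_setT ltry.
- exact: cts_measurable.
- exists (unif_norm f); split; first exact: num_real.
  by move=> M fM x _ /=; exact: le_trans (le_unif_norm compX f x) (ltW fM).
Qed.

End borel_integral.

(** * The integral against the constructed measure equals the state *)

Section riesz_representation.
Context (R : realType) (X : ptopologicalType).
Hypotheses (hausX : hausdorff_space X) (compX : compact [set: X]).
Local Notation C := (continuousType X R).
Local Notation borel := (g_sigma_algebraType (@open X)).
Variables (mu : {scalar C}) (smu : states mu).

Let P := riesz_probability hausX compX smu.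
Let I (f : C) : R := \int[P]_x f x.

Let ID (f g : C) : I (f + g) = I f + I g.
Proof. by rewrite /I RintegralD//; exact: cts_integrable. Qed.

Let I_le (f g : C) : (forall x, f x <= g x) -> I f <= I g.
Proof. by move=> fg; apply: le_Rintegral => //; exact: cts_integrable. Qed.

Let I_cst (a : R) : I (a *: (1 : C)) = a.
Proof.
rewrite /I (_ : (fun x => _) = (fun=> a)); last first.
  by apply/funext => x; rewrite !ctsE mulr1.
rewrite Rintegral_cst//.
have := probability_setT P; set p := P _ => p1.
by rewrite (_ : fine _ = 1) ?mulr1// -[RHS]/(fine 1%E) -p1.
Qed.

(** Differences of truncations at successive heights slice [f] into layers. *)
Let cut (f : C) (a : R) : C := cmin f (a *: (1 : C)).

Let cutE f a x : cut f a x = Num.min (f x) a.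
Proof. by rewrite -[LHS]/(Num.min (f x) (a * 1)) mulr1. Qed.

(* Both sides are compared with [d * P {f > a + d}]. *)
Let layer_le (f : C) (a d : R) : 0 < d ->
  mu (cut f (a + d + d)) - mu (cut f (a + d)) <= I (cut f (a + d)) - I (cut f
    a).
Proof.
move=> d0.
pose U : set X := [set x | a + d < f x].
have oU : open U by exact: cts_open_gt.
have mU : measurable (U : set borel) by exact: open_borel.
have PUE : P U = open_content mu U by exact: riesz_outer_open.
have b : bump U (d^-1 *: (cut f (a + d + d) - cut f (a + d))).
  split=> x; rewrite !ctsE !cutE.
    have -> : 0 <= d^-1 * (Num.min (f x) (a + d + d) - Num.min (f x) (a + d)).
      rewrite mulr_ge0 ?invr_ge0 ?(ltW d0)//.
      by case: (leP (f x) (a + d)) => ?; case: (leP (f x) (a + d + d)) => ?;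
        lra.
    rewrite mulrC ler_pdivrMr// mul1r.
    by case: (leP (f x) (a + d)) => ?; case: (leP (f x) (a + d + d)) => ?; lra.
  move=> /negP; rewrite -leNgt => fx.
  by rewrite !min_l ?subrr ?mulr0//; lra.
have PUfin : P U \is a fin_num by exact: fin_num_measure.
have : d * fine (P U) <= I (cut f (a + d)) - I (cut f a).
  have -> : I (cut f (a + d)) - I (cut f a) = I (cut f (a + d) - cut f a).
    by apply/eqP; rewrite subr_eq -ID subrK.
  have intU : P.-integrable setT (EFin \o \1_U) by exact: integrable_indic.
  have -> : fine (P U) = \int[P]_x \1_U x.
    by rewrite /Rintegral integral_indic// setIT.
  rewrite -RintegralZl//; apply: le_Rintegral => //.
  - exact: (integrableZl measurableT d intU).
  - exact: cts_integrable.
  - move=> x _; rewrite !ctsE !cutE indicE.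
    have [fx|fx] := ltP (a + d) (f x).
      rewrite mem_set// mulr1.
      by case: (leP (f x) (a + d)) => ?; case: (leP (f x) a) => ?; lra.
    rewrite memNset ?mulr0; last by rewrite /U/= ltNge fx.
    by case: (leP (f x) (a + d)) => ?; case: (leP (f x) a) => ?; lra.
apply: le_trans.
have := bump_le_open_content mu b; rewrite -PUE -(fineK PUfin) lee_fin.
rewrite (stateZ mu) (stateB mu) mulrC ler_pdivrMr// => H.
by rewrite mulrC.
Qed.

(** Telescoping [layer_le] over the heights [n * d] compares each layer under [mu] with the layer
    just below it under the integral; the shift by one layer costs [d]. *)
Let mu_le_I (f : C) : nonneg f -> mu f <= I f.
Proof.
move=> f0; apply/ler_addgt0Pr => d d0.
(* [N * d] lies above [f], so truncation at that height changes nothing. *)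
pose N := (Num.trunc (unif_norm f / d)).+1.
have key n : mu (cut f (n%:R * d + d)) <= d + I (cut f (n%:R * d)).
  elim: n => [|n IH].
    rewrite mul0r add0r -[leLHS]addr0; apply: lerD.
      by apply: (state_le_cst smu) => x; rewrite cutE ge_min lexx orbT.
    rewrite -[leLHS](I_cst 0) scale0r; apply: I_le => x.
    by rewrite cutE ctsE le_min f0 lexx.
  have := layer_le f (n%:R * d) d0.
  rewrite -[n.+1%:R]natr1 mulrDl mul1r; move: IH.
  move: (mu (cut f (n%:R * d + d + d))) (mu (cut f (n%:R * d + d))) => a b.
  move: (I (cut f (n%:R * d + d))) (I (cut f (n%:R * d))) => a' b'.
  by move=> *; lra.
have fN x : f x <= N%:R * d.
  rewrite -ler_pdivrMr// ltW// /N.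
  apply: le_lt_trans (truncnS_gt _).
  rewrite ler_pM2r ?invr_gt0//.
  exact: le_trans (ler_norm _) (le_unif_norm compX f x).
have := key N.
have -> : cut f (N%:R * d + d) = f.
  by apply: cts_ext => x; rewrite cutE min_l//; have := fN x; lra.
have -> : cut f (N%:R * d) = f by apply: cts_ext => x; rewrite cutE min_l.
by rewrite addrC.
Qed.

(** Adding the constant |f| extends the inequality from nonnegative functions to all [f]; using it
    for [- f] as well gives equality. *)
Lemma riesz_probability_represents : represents P mu.
Proof.
have le_I (f : C) : mu f <= I f.
  have := @mu_le_I (f + unif_norm f *: (1 : C)).
  rewrite (stateD mu) ID I_cst (state_cst smu) lerD2r; apply => x.
  have := le_unif_norm compX f x.
  by rewrite !ctsE mulr1 ler_norml => /andP[]; lra.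
move=> f; have muI : mu f = I f.
  have I0 : I 0 = 0 by rewrite -[0 : C](scale0r (1 : C)) I_cst.
  apply/eqP; rewrite eq_le le_I -lerN2 -(stateN mu)/=.
  have -> : - I f = I (- f).
    by apply/eqP; rewrite eq_sym -subr_eq0 opprK -ID addNr I0.
  exact: le_I.
rewrite muI /I /Rintegral fineK//; apply: integrable_fin_num => //.
exact: cts_integrable.
Qed.

End riesz_representation.

(** * The integral of ln psi as the limit of mu(ln (psi + d)) *)

Section integral_of_log.
Context (R : realType) (X : ptopologicalType).
Hypotheses (hausX : hausdorff_space X) (compX : compact [set: X]).
Local Notation C := (continuousType X R).
Local Notation borel := (g_sigma_algebraType (@open X)).
Variables (mu : {scalar C}) (smu : states mu).

Lemma riesz_measure_represents : represents (riesz_measure mu) mu.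
Proof.
have : [set P : probability borel R | regular_measure P /\ represents P mu]
    (riesz_measure mu).
  apply: getPex; exists (riesz_probability hausX compX smu); split.
    exact: riesz_probability_regular.
  exact: riesz_probability_represents.
by case.
Qed.

Variables (psi : C) (psi_ge0 : nonneg psi).

Lemma add_cst_gt0 (d : R) : 0 < d -> forall x, 0 < (psi + d *: (1 : C)) x.
Proof. by move=> d0 x; rewrite !ctsE mulr1 ltr_wpDl. Qed.

Let P := riesz_measure mu.
Let lpsi (x : borel) : \bar R := lne (psi x)%:E.

Let mlpsi : measurable_fun setT lpsi.
Proof.
apply: (measurability _ (ErealGenOInfty.measurableE R)) => //.
move=> _ [_ [r ->] <-]; rewrite setTI; apply: open_borel.
suff -> : lpsi @^-1` `]r%:E, +oo[%classic = [set x | expR r < psi x].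
  exact: cts_open_gt.
apply/seteqP; split => x /=; rewrite in_itv/= andbT /lpsi/=.
  case: ifPn => //; rewrite -ltNge => px; rewrite lte_fin => H.
  by rewrite -[ltRHS](lnK px) ltr_expR.
move=> H; have px : 0 < psi x by apply: lt_trans H; exact: expR_gt0.
rewrite leNgt px/= lte_fin.
by rewrite -ltr_expR (lnK px).
Qed.

Lemma integral_ln_le (d : R) (d0 : 0 < d) :
  (integral_ln psi mu <= (mu (cln (add_cst_gt0 d0)))%:E)%E.
Proof.
rewrite riesz_measure_represents /integral_ln -/P.
have mg : measurable_fun setT (fun x : borel => (cln (add_cst_gt0 d0) x)%:E).
  by apply/measurable_EFinP; exact: cts_measurable.
have le_lpsi x : (lpsi x <= (cln (add_cst_gt0 d0) x)%:E)%E.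
  have -> : cln (add_cst_gt0 d0) x = ln (psi x + d).
    by rewrite -[LHS]/(ln (psi x + d * 1)) mulr1.
  rewrite /lpsi/=; case: ifPn => [_|]; first exact: leNye.
  rewrite -ltNge lee_fin => px.
  by rewrite ler_ln ?posrE ?addr_gt0// lerDl ltW.
(* The integral of [lpsi] may be -oo, so positive and negative parts are compared separately. *)
rewrite integralE [leRHS]integralE; apply: leeB.
  apply: ge0_le_integral => //.
  - exact: measurable_funepos.
  - exact: measurable_funepos.
  - by move=> x _; apply: (@funepos_le _ _ setT _ _ (fun y _ => le_lpsi y));
    rewrite in_setT.
apply: ge0_le_integral => //.
- exact: measurable_funeneg.
- exact: measurable_funeneg.
- by move=> x _; apply: (@funeneg_le _ _ setT _ _ (fun y _ => le_lpsi y));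
  rewrite in_setT.
Qed.

(** The positive part of ln psi integrates to the finite number mu(ln max(psi, 1)). The negative
    parts [g_ n] of ln (psi + 1/(n+1)) increase to that of ln psi, so monotone convergence bounds
    its integral. *)
Lemma integral_ln_ge (r : R) :
  (forall (d : R) (d0 : 0 < d), r <= mu (cln (add_cst_gt0 d0))) ->
  (r%:E <= integral_ln psi mu)%E.
Proof.
move=> rle; rewrite /integral_ln -/P.
have L0 x : 0 < cmax psi 1 x by rewrite lt_max ltr01 orbT.
have Pint (f : C) : (\int[P]_x (f x)%:E)%E = (mu f)%:E.
  by rewrite riesz_measure_represents.
have fposE : (\int[P]_x lpsi^\+ x)%E = (mu (cln L0))%:E.
  rewrite -Pint; apply: eq_integral => x _; rewrite funeposE /lpsi/=.
  case: (leP (psi x) 0) => px.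
    by rewrite max_r ?leNye// max_r ?ln1// (le_trans px).
  have [p1|p1] := leP (psi x) 1.
    by rewrite max_r ?ln1// lee_fin -ln1 ler_ln ?posrE.
  by rewrite max_l// lee_fin ln_ge0// ltW.
pose dl n : R := n.+1%:R^-1.
have dl0 n : 0 < dl n by rewrite invr_gt0 ltr0n.
pose f_ n : C := cln (add_cst_gt0 (dl0 n)).
have f_E n x : f_ n x = ln (psi x + dl n).
  by rewrite /f_ -[LHS]/(ln (psi x + dl n * 1)) mulr1.
pose g_ n (x : borel) : \bar R := (cmax (- f_ n) 0 x)%:E.
have g_E n x : g_ n x = (Num.max (- f_ n x) 0)%:E by [].
have mg n : measurable_fun setT (g_ n).
  by apply/measurable_EFinP; exact: cts_measurable.
have g0 n x : (0 <= g_ n x)%E by rewrite g_E lee_fin le_max lexx orbT.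
have pd n x : 0 < psi x + dl n by rewrite ltr_wpDl.
have gmono x : {homo g_^~ x : n m / (n <= m)%N >-> (n <= m)%E}.
  move=> n m nm; rewrite !g_E lee_fin ge_max le_max le_max lexx orbT andbT.
  rewrite lerN2 !f_E ler_ln ?posrE// lerD2l lef_pV2 ?posrE ?ltr0n//.
  by rewrite ler_nat ltnS nm.
have cvgI : ((\int[P]_x g_ n x)%E @[n --> \oo] -->
    (\int[P]_x limn (g_^~ x))%E).
  by apply: cvg_monotone_convergence.
(* By monotonicity [n] may be replaced by a larger [m] with [dl m <= e]; there [g_ m + f_ m] is the
   positive part of ln (psi + dl m), at most ln max(psi, 1) + e. *)
have gle n : (\int[P]_x g_ n x <= (mu (cln L0) - r)%:E)%E.
  rewrite /g_ Pint lee_fin; apply/ler_addgt0Pr => e e0.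
  pose m := maxn n (Num.trunc e^-1).
  have dme : dl m <= e.
    rewrite /dl -[leRHS]invrK lef_pV2 ?posrE ?ltr0n ?invr_gt0//.
    apply: ltW; apply: lt_le_trans (truncnS_gt _) _.
    by rewrite ler_nat ltnS leq_maxr.
  have nm : mu (cmax (- f_ n) 0) <= mu (cmax (- f_ m) 0).
    apply: (state_le smu) => x; rewrite -lee_fin.
    exact: gmono (leq_maxl _ _).
  apply: (le_trans nm); have := rle _ (dl0 m); rewrite -/(f_ m) => rm.
  suff : mu (cmax (- f_ m) 0) + mu (f_ m) <= mu (cln L0) + e.
    move: rm; move: (mu (cmax _ _)) (mu (f_ m)) (mu (cln L0)) => u v w.
    by move=> *; lra.
  rewrite -[in leRHS](state_cst smu e) -!(stateD mu).
  apply: (state_le smu) => x; rewrite !ctsE mulr1.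
  rewrite -[cmax _ _ x]/(Num.max (- f_ m x) 0).
  rewrite -[cln L0 x]/(ln (Num.max (psi x) 1)) f_E.
  (* With M = max(psi, 1) >= 1 one has psi + e <= M (1 + e) <= M exp(e). *)
  have H : ln (psi x + dl m) <= ln (Num.max (psi x) 1) + e.
    rewrite -[e in leRHS]expRK -lnM ?posrE ?expR_gt0//; last exact: L0.
    rewrite ler_ln ?posrE ?pd ?mulr_gt0 ?expR_gt0//; last exact: L0.
    have := expR_ge1Dx e; set M := Num.max _ _ => e1.
    have M1 : 1 <= M by rewrite le_max lexx orbT.
    have pM : psi x <= M by rewrite le_max lexx.
    apply: (@le_trans _ _ (M * (1 + e))); first by nra.
    by rewrite ler_wpM2l// (le_trans ler01).
  have H' : 0 <= ln (Num.max (psi x) 1).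
    by rewrite ln_ge0// le_max lexx orbT.
  by case: (leP (- ln (psi x + dl m)) 0) => ?; lra.
have fneg_le : (\int[P]_x lpsi^\- x <= (mu (cln L0) - r)%:E)%E.
  apply: (@le_trans _ _ (\int[P]_x limn (g_^~ x))%E); last first.
    move/cvg_lim : cvgI => <-//; apply: lime_le.
      apply: ereal_nondecreasing_is_cvgn => n m nm.
      apply: (@ge0_le_integral _ _ _ _ _ measurableT).
      - by move=> x _; exact: g0.
      - exact: mg.
      - exact: mg.
      - by move=> x _; exact: (gmono x n m nm).
    by apply: nearW.
  apply: ge0_le_integral => //.
  - exact: measurable_funeneg.
  - by apply: (emeasurable_fun_cvg g_) => // x _;
    apply: ereal_nondecreasing_is_cvgn; exact: gmono.
  move=> x _; have -> : limn (g_^~ x) = ereal_sup (range (g_^~ x)).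
    by apply/cvg_lim => //; exact: ereal_nondecreasing_cvgn.
  set s := ereal_sup _.
  have gs n : (g_ n x <= s)%E by apply: ereal_sup_ubound; exists n.
  rewrite funenegE ge_max (le_trans (g0 0 x) (gs 0)) andbT.
  case: s gs => [s| |] gs; [|by rewrite leey|]; last first.
    by have := le_trans (g0 0 x) (gs 0).
  (* A finite supremum [s] keeps every [psi x + dl m] above [expR (- s)], hence [psi x] too. *)
  have ps : expR (- s) <= psi x.
    apply/ler_addgt0Pr => e e0; pose m := Num.trunc e^-1.
    have dme : dl m <= e.
      rewrite /dl -[leRHS]invrK lef_pV2 ?posrE ?ltr0n ?invr_gt0//.
      by apply: ltW; exact: truncnS_gt.
    apply: (@le_trans _ _ (psi x + dl m)); last by rewrite lerD2l.
    rewrite -ler_ln ?posrE ?expR_gt0// expRK.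
    have := gs m; rewrite g_E lee_fin ge_max f_E => /andP[+ _]; lra.
  have px : 0 < psi x by exact: lt_le_trans (expR_gt0 _) ps.
  rewrite leeNl /lpsi lne_EFin// -EFinN lee_fin.
  by rewrite -[leLHS]expRK ler_ln ?posrE ?expR_gt0.
rewrite integralE -/lpsi fposE.
have : ((mu (cln L0))%:E - (mu (cln L0) - r)%:E <=
  (mu (cln L0))%:E - \int[P]_x lpsi^\- x)%E by rewrite leeB.
by rewrite -EFinB opprB addrC subrK.
Qed.

End integral_of_log.

(** * Spectral radius of weighted transfer operators *)

Section fekete.
Context (R : realType) (a : nat -> R).
Hypotheses (a_ge0 : forall n, 0 <= a n)
  (a_submul : forall n m, a (n + m)%N <= a n * a m).

Let u n : \bar R := ((n%:R^-1)%:E * lne (a n)%:E)%E.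

Let u_NyP n : (0 < n)%N -> a n = 0 -> u n = -oo%E.
Proof.
move=> n0 an0; rewrite /u an0 /= lexx.
by rewrite mulr_infty gtr0_sg ?invr_gt0 ?ltr0n// mul1e.
Qed.

Let u_EFin n : 0 < a n -> u n = (n%:R^-1 * ln (a n))%:E.
Proof. by move=> an0; rewrite /u lne_EFin. Qed.

Let submul_iter N q r : a (q * N + r)%N <= a N ^+ q * a r.
Proof.
elim: q => [|q IH]; first by rewrite mul0n add0n expr0 mul1r.
rewrite mulSn -addnA exprS -mulrA; apply: le_trans (a_submul _ _) _.
exact: ler_wpM2l.
Qed.

(** Euclidean division of [n] by [N] bounds [a n] by a power of [a N] times a remainder term. With a
    N = exp(b' N) this gives ln (a n) <= K + b' n, and [K] is absorbed by (b - b') n for large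
    [n]. *)
Let eventually_le N (b : R) : (0 < N)%N -> (u N < b%:E)%E ->
  \forall n \near \oo, (u n <= b%:E)%E.
Proof.
move=> N0 uNb; have [aN0|aN0] := eqVneq (a N) 0.
  exists N.+1 => // n /= Nn; rewrite u_NyP ?leNye//.
    exact: leq_trans Nn.
  apply/eqP; rewrite eq_le a_ge0 andbT -(subnKC (ltnW Nn)).
  by apply: le_trans (a_submul _ _) _; rewrite aN0 mul0r.
have {}aN0 : 0 < a N by rewrite lt_neqAle eq_sym aN0 a_ge0.
have NR0 : (0 : R) < N%:R by rewrite ltr0n.
move: uNb; rewrite u_EFin// lte_fin; set b' := _ * _ => b'b.
have aNE : a N = expR (b' * N%:R) by rewrite /b' mulrAC mulVf ?gt_eqF// mul1r
  lnK.
pose M := 1 + \sum_(r < N) a r.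
have M0 : 0 < M by rewrite ltr_pwDl// sumr_ge0.
have aM r : (r < N)%N -> a r <= M.
  move=> rN; rewrite /M (bigD1 (Ordinal rN))//= addrCA lerDl.
  by rewrite addr_ge0// sumr_ge0.
(* The second term pays for replacing [q * N] by [n] in the exponent, whatever the sign of [b']. *)
pose K := ln M + `|b'| * N%:R.
have bound n : a n <= expR (K + b' * n%:R).
  rewrite {1}(divn_eq n N); apply: le_trans (submul_iter _ _ _) _.
  apply: le_trans (ler_wpM2l _ (aM _ (ltn_pmod n N0))) _.
    by rewrite exprn_ge0.
  rewrite aNE -expRM_natl -[M]lnK ?posrE// -expRD ler_expR.
  rewrite [in leRHS](divn_eq n N) natrD natrM /K mulrDr.
  have rN : (n %% N)%:R <= N%:R :> R by rewrite ler_nat ltnW// ltn_pmod.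
  have : - (`|b'| * N%:R) <= b' * (n %% N)%:R.
    apply: (@le_trans _ _ (- (`|b'| * (n %% N)%:R))).
      by rewrite lerN2 ler_wpM2l.
    by rewrite -mulNr ler_wpM2r// lerNl ler_normr lexx orbT.
  lra.
exists (Num.trunc (`|K| / (b - b'))).+1 => // n /= Kn.
have n0 : (0 < n)%N by exact: leq_trans Kn.
have [an0|an0] := eqVneq (a n) 0; first by rewrite u_NyP ?leNye.
have {}an0 : 0 < a n by rewrite lt_neqAle eq_sym an0 a_ge0.
rewrite u_EFin// lee_fin mulrC ler_pdivrMr ?ltr0n//.
have := bound n; rewrite -ler_ln ?posrE ?expR_gt0// expRK => /le_trans; apply.
have : `|K| <= n%:R * (b - b').
  rewrite -ler_pdivrMr ?subr_gt0// ltW//; apply: lt_le_trans (truncnS_gt _) _.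
  by rewrite ler_nat.
by have := ler_norm K; rewrite mulrBr; lra.
Unshelve. all: by end_near. Qed.

(** Zeros of [a] are allowed: one zero value makes all later ones zero and the limit -oo. The
    infimum is never +oo because [u 1] is not. *)
Lemma fekete : limn u = ereal_inf [set u n | n in [set n | (0 < n)%N]].
Proof.
set L := ereal_inf _.
have L_le n : (0 < n)%N -> (L <= u n)%E.
  by move=> n0; apply: ereal_inf_lbound; exists n.
have above b : (L < b%:E)%E -> \forall n \near \oo, (u n <= b%:E)%E.
  by move=> /ereal_inf_lt[_ [N N0 <-]]; exact: eventually_le.
apply/cvg_lim => //; case: L L_le above => [l| |] L_le above.
- have bnd (e : R) : 0 < e ->
      \forall n \near \oo, (l%:E <= u n)%E /\ (u n <= (l + e)%:E)%E.
    move=> e0; near=> n; split; last by near: n; apply: above;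
      rewrite lte_fin ltrDl.
    by apply: L_le; near: n; exists 1%N.
  apply/fine_cvgP; split.
    have := bnd 1 ltr01; apply: filterS => n [H1 H2].
    rewrite fin_numE; apply/andP; split.
      by rewrite gt_eqF// (lt_le_trans _ H1)// ltNyr.
    by rewrite lt_eqF// (le_lt_trans H2)// ltry.
  apply/cvgrPdist_le => e e0; have := bnd e e0; apply: filterS => n /= [].
  case: (u n) => [x| |]//=; rewrite !lee_fin => H1 H2.
  by rewrite ler_norml; apply/andP; split; lra.
- have := L_le 1%N isT; rewrite leye_eq /u /=.
  by case: ifPn => _; rewrite ?mul1e// invr1 mul1e.
- by apply/cvgeNyPle => b; apply: above; exact: ltNyr.
Unshelve. all: by end_near. Qed.

End fekete.

(** * Iterates of positive operators and Gelfand's formula *)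

Section linear_iterates.
Context (R : realType) (X : ptopologicalType).
Local Notation C := (continuousType X R).

Definition mklinear (F : C -> C) (lF : linear F) : {linear C -> C} :=
  HB.pack F (GRing.isLinear.Build R C C _ F lF).

Lemma iter_linear (B : {linear C -> C}) n : linear (iter n B).
Proof. by elim: n => // n IH a f g; rewrite /= IH linearP. Qed.

Definition lin_iter (B : {linear C -> C}) n := mklinear (iter_linear B n).

Lemma weighted_linear (A : {linear C -> C}) (psi : C) :
  linear (weighted A psi).
Proof.
move=> a f g; rewrite /weighted.
have -> : psi * (a *: f + g) = a *: (psi * f) + psi * g.
  by apply: cts_ext => x; rewrite !ctsE mulrDr mulrCA.
by rewrite linearP.
Qed.

Definition weighted_lin A psi := mklinear (weighted_linear A psi).

Definition positive (B : {linear C -> C}) :=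
  forall f : C, nonneg f -> nonneg (B f).

Lemma lin_iter_pos B n : positive B -> positive (lin_iter B n).
Proof. by move=> Bpos f f0; elim: n => //= n IH; exact: Bpos. Qed.

Hypothesis (compX : compact [set: X]).

Section log_spectral_radius_inf.
Variables (B : {linear C -> C}) (Bpos : positive B).

Lemma log_spectral_radiusE : log_spectral_radius B =
  ereal_inf [set ((n%:R^-1)%:E * lne (unif_norm (iter n B 1))%:E)%E
    | n in [set n | (0 < n)%N]].
Proof.
rewrite -fekete.
- rewrite /log_spectral_radius; congr (limn _); apply/funext => n.
  by rewrite -[iter n B]/(lin_iter B n : C -> C) op_normE//;
    exact: lin_iter_pos.
- by move=> n; exact: unif_norm_ge0.
- move=> n m; rewrite iterD mulrC.
  exact: (unif_norm_pos_le compX (lin_iter_pos n Bpos)).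
Qed.

End log_spectral_radius_inf.

End linear_iterates.

(** * Birkhoff products and iterates of weighted transfer operators *)

Section transfer_operator.
Context (R : realType) (X : ptopologicalType).
Local Notation C := (continuousType X R).
Variables (alpha : continuousType X X) (A : {linear C -> C}).
Hypothesis transA : is_transfer_operator alpha A.

(** The [k]-th power of the Koopman operator of [alpha]. *)
Fixpoint shift k (f : C) : C := if k is j.+1 then (shift j f \o alpha : C) else
  f.

Lemma shiftE k f x : shift k f x = f (iter k alpha x).
Proof. by elim: k x => // k IH x; rewrite iterSr -IH. Qed.

Definition bprod n (f : C) : C := \prod_(k < n) shift k f.

Definition bsum n (f : C) : C := \sum_(k < n) shift k f.

Lemma bprodE n f x : bprod n f x = \prod_(k < n) f (iter k alpha x).
Proof. by rewrite /bprod cts_prodE; under eq_bigr do rewrite shiftE. Qed.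

Lemma bsumE n f x : bsum n f x = \sum_(k < n) f (iter k alpha x).
Proof. by rewrite /bsum cts_sumE; under eq_bigr do rewrite shiftE. Qed.

Lemma bprod_ge0 n f : nonneg f -> nonneg (bprod n f).
Proof. by move=> f0 x; rewrite bprodE prodr_ge0. Qed.

Lemma bprod_exp n f x : bprod n (cexp f) x = expR (bsum n f x).
Proof. by rewrite bprodE bsumE expR_sum. Qed.

Lemma transfer_pos : positive A. Proof. by case: transA. Qed.

Lemma iter_transfer n (f g : C) :
  iter n A (shift n f * g) = f * iter n A g.
Proof.
elim: n g => [//|n IH] g.
by rewrite [LHS]iterSr [shift _ _]/= transA.2 IH -iterSr.
Qed.

(** The transfer identity carries psi_n inside the innermost [A] as psi_n o alpha, and psi_(n+1) =
    psi (psi_n o alpha). *)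
Lemma iter_weighted (psi : C) n f :
  iter n (weighted A psi) f = iter n A (bprod n psi * f).
Proof.
elim: n f => [|n IH] f; first by rewrite /bprod big_ord0 mul1r.
rewrite iterSr IH iterSr /weighted -transA.2 mulrA;
  congr (iter _ _ (A (_ * _))).
apply: cts_ext => x; rewrite !ctsE !bprodE big_ord_recl mulrC.
by congr (_ * _); apply: eq_bigr => i _; rewrite iterSr.
Qed.

Hypothesis (compX : compact [set: X]).

Lemma spectral_radius_weighted (psi : C) : nonneg psi ->
  log_spectral_radius (weighted A psi) =
  ereal_inf [set ((n%:R^-1)%:E * lne (unif_norm (iter n A (bprod n psi)))%:E)%E
    | n in [set n | (0 < n)%N]].
Proof.
move=> psi0; rewrite -[weighted A psi]/(weighted_lin A psi : C -> C).
rewrite (log_spectral_radiusE compX); last first.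
  by move=> f f0; apply: transfer_pos => x; rewrite !ctsE mulr_ge0.
congr ereal_inf; apply: eq_imagel => n _.
have -> : iter n (weighted_lin A psi) 1 = iter n A (bprod n psi).
  by rewrite -[RHS](congr1 _ (mulr1 _)) -iter_weighted.
by [].
Qed.

End transfer_operator.

(** * Jensen inequalities for the t-entropy *)

Section entropy_sums.
Context (R : realType).

Lemma le_lne_EFin (x y : R) : x <= y -> (lne x%:E <= lne y%:E)%E.
Proof.
move=> xy; have [x0|x0] := leP x 0; first by rewrite le0_lneNy ?lee_fin ?leNye.
have y0 := lt_le_trans x0 xy.
by rewrite !lne_EFin// lee_fin ler_ln.
Qed.

Context (I : eqType) (r : seq I) (p v : I -> R).
Hypothesis (p0 : forall i, i \in r -> 0 <= p i).

(** The inner sum of [tau_part], with [p] standing for mu(g) and [v] for m(A^n g). *)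
Definition entropy_sum : \bar R := (\sum_(i <- r)
  if p i == 0%R then 0 else (p i)%:E * lne (v i / p i)%:E)%E.

Lemma entropy_sum_EFin : (forall i, i \in r -> p i != 0 -> 0 < v i) ->
  entropy_sum = (\sum_(i <- r) p i * ln (v i / p i))%:E.
Proof.
move=> v0; rewrite -sumEFin /entropy_sum big_seq [RHS]big_seq.
apply: eq_bigr => i ir; case: ifPn => [/eqP->|pi0]; first by rewrite mul0r.
rewrite lne_EFin// divr_gt0 ?v0// lt_neqAle eq_sym pi0; exact: p0.
Qed.

Lemma entropy_sum_Ny i : i \in r -> p i != 0 -> v i <= 0 ->
  entropy_sum = -oo%E.
Proof.
move=> ir pi0 vi0; apply/esum_eqNyP; exists i; split => //;
  rewrite (negbTE pi0).
have {}pi0 : 0 < p i by rewrite lt_neqAle eq_sym pi0 p0.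
have vp0 : v i / p i <= 0 by rewrite pmulr_lle0 ?invr_gt0.
by rewrite le0_lneNy ?lee_fin// mulr_infty gtr0_sg// mul1e.
Qed.

(** Jensen's inequality for ln with weights [p]. If some [v i] vanishes while [p i > 0], the left
    side is -oo. *)
Lemma entropy_sum_le (c : I -> R) : \sum_(i <- r) p i = 1 ->
  (forall i, i \in r -> 0 <= v i) ->
  (entropy_sum + (\sum_(i <- r) p i * c i)%:E <=
    lne (\sum_(i <- r) expR (c i) * v i)%:E)%E.
Proof.
move=> p1 v0.
have [H|/existsNP[i /not_implyP[ir /not_implyP[pi0 /negP vi0]]]] :=
    pselect (forall i, i \in r -> p i != 0 -> 0 < v i); last first.
  by rewrite (entropy_sum_Ny ir pi0) ?leNye// leNgt.
rewrite entropy_sum_EFin//; set s := \sum_(i <- r) expR _ * _.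
have s_ge0 : 0 <= s.
  by rewrite /s big_seq sumr_ge0// => i ir; rewrite mulr_ge0 ?expR_ge0 ?v0.
have s0 : 0 < s.
  rewrite lt_neqAle s_ge0 andbT eq_sym; apply/eqP => s0.
  have : \sum_(i <- r) p i = 0.
    rewrite big_seq big1// => i ir; apply/eqP/negPn/negP => pi0.
    have : expR (c i) * v i <= s.
      rewrite /s (big_rem i)//= lerDl big_seq sumr_ge0// => j /mem_rem jr.
      by rewrite mulr_ge0 ?expR_ge0 ?v0.
    by rewrite s0 leNgt mulr_gt0 ?expR_gt0 ?H.
  by rewrite p1 => /eqP; rewrite oner_eq0.
rewrite lne_EFin// -EFinD lee_fin -subr_le0.
have -> : \sum_(i <- r) p i * ln (v i / p i) + \sum_(i <- r) p i * c i - ln s =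
    \sum_(i <- r) (p i * ln (v i / p i) + p i * c i - p i * ln s).
  by rewrite sumrB big_split/= -mulr_suml p1 mul1r.
(* Termwise ln y <= y - 1 at y = exp(c i) v i / (s p i); these bounds add up to zero. *)
apply: (@le_trans _ _ (\sum_(i <- r) (expR (c i) * v i / s - p i))); last first.
  by rewrite sumrB p1 -mulr_suml -/s divff ?gt_eqF// subrr.
rewrite big_seq [leRHS]big_seq; apply: ler_sum => i ir.
have [->|pi0] := eqVneq (p i) 0.
  by rewrite !mul0r addr0 !subr0 divr_ge0 ?mulr_ge0 ?expR_ge0 ?v0.
have vi0 := H i ir pi0.
have {}pi0 : 0 < p i by rewrite lt_neqAle eq_sym pi0 p0.
have -> : p i * ln (v i / p i) + p i * c i - p i * ln s =
    p i * ln (expR (c i) * v i / s / p i).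
  rewrite -mulrDr -mulrBr; congr (_ * _).
  rewrite -[in LHS](expRK (c i)) -lnM ?posrE ?divr_gt0 ?expR_gt0//.
  rewrite -ln_div ?posrE ?mulr_gt0 ?divr_gt0 ?expR_gt0// ?invr_gt0//.
  by congr ln; field; rewrite !gt_eqF.
have -> : expR (c i) * v i / s - p i = p i * (expR (c i) * v i / s / p i - 1).
  by field; rewrite !gt_eqF.
rewrite ler_wpM2l ?(ltW pi0)//.
set y := _ / p i; have y0 : 0 < y.
  by rewrite !divr_gt0 ?mulr_gt0 ?expR_gt0.
rewrite -[y in leLHS](subrKC 1); apply: le_ln1Dx; lra.
Qed.

End entropy_sums.

(** * Partitions of unity adapted to a given function *)

Section partitions.
Context (R : realType) (X : ptopologicalType).
Local Notation C := (continuousType X R).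

(* A partition of unity is a set of functions, so repeated members of a family
   have to be merged before its sum can be read off. *)
Lemma merge_duplicates (P : C -> Prop) (s : seq C) :
  (forall g, P g -> P (g + g)) -> (forall g, g \in s -> P g) ->
  exists D : {fset C}, (forall g, g \in D -> P g) /\
    \sum_(g <- D) g = \sum_(g <- s) g.
Proof.
move=> Pdbl; have insert n : forall (D : {fset C}) g, (#|` D| <= n)%N ->
    P g -> (forall h, h \in D -> P h) ->
    exists D' : {fset C}, (forall h, h \in D' -> P h) /\
      \sum_(h <- D') h = g + \sum_(h <- D) h.
  elim: n => [|n IH] D g cD Pg PD; have [gD|gD] := boolP (g \in D).
  - by move: cD; rewrite leqn0 => /eqP/cardfs0_eq D0; rewrite D0 in gD.
  - exists (g |` D)%fset; split; last by rewrite big_fsetU1.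
    by move=> h; rewrite in_fset1U => /orP[/eqP->|/PD].
  - have [|||D' [PD' D'E]] := IH (D `\ g)%fset (g + g).
    + by move: cD; rewrite (cardfsD1 g D) gD.
    + exact: Pdbl.
    + by move=> h; rewrite in_fsetD1 => /andP[_ /PD].
    + by exists D'; split=> //; rewrite D'E (big_fsetD1 g gD)/= addrA.
  - exists (g |` D)%fset; split; last by rewrite big_fsetU1.
    by move=> h; rewrite in_fset1U => /orP[/eqP->|/PD].
elim: s => [|g s IH] Ps.
  by exists fset0; split => [h|]; rewrite ?in_fset0// big_seq_fset0 big_nil.
have [D [PD DE]] : exists D : {fset C}, (forall g, g \in D -> P g) /\
    \sum_(g <- D) g = \sum_(g <- s) g.
  by apply: IH => h hs; apply: Ps; rewrite inE hs orbT.
have [D' [PD' D'E]] := insert _ D g (leqnn _) (Ps _ (mem_head _ _)) PD.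
by exists D'; split => //; rewrite D'E DE big_cons.
Qed.

Hypothesis compX : compact [set: X].

(** The members are hat functions of [t], an affine rescaling of [F] in units of [d = e / 2]. Each
    is a difference of consecutive clamped ramps [h i], so that the sum telescopes. *)
Lemma fine_partition (F : C) (e : R) : 0 < e ->
  exists2 D : {fset C}, partition_of_unity D & forall g, g \in D ->
    exists c : R, forall x, c * g x <= F x * g x <= (c + e) * g x.
Proof.
move=> e0; pose P (g : C) := nonneg g /\
  exists c : R, forall x, c * g x <= F x * g x <= (c + e) * g x.
suff [s [Ps sE]] : exists s : seq C, (forall g, g \in s -> P g) /\
    \sum_(g <- s) g = 1.
  have [g [g0 [c cP]]|D [PD DE]] := merge_duplicates _ Ps.
    split=> [x|]; first by rewrite ctsE addr_ge0.
    exists c => x; rewrite !ctsE !mulrDr; have /andP[? ?] := cP x.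
    by rewrite !lerD.
  exists D; last by move=> g /PD[].
  by split; [move=> g /PD[]|rewrite DE].
pose K := unif_norm F; pose d := e / 2.
have d0 : 0 < d by rewrite divr_gt0.
pose t x := (F x + K) / d.
have t0 x : 0 <= t x.
  rewrite divr_ge0 ?(ltW d0)//; have := le_unif_norm compX F x.
  by rewrite ler_norml -/K => /andP[]; lra.
have FE x : F x = t x * d - K by rewrite /t divfK ?gt_eqF// addrK.
(* [L >= t + 1] gives [h L = 0], while [t >= 0] gives [h 0 = 1]; the telescoping sum is therefore
   1. *)
pose L := (Num.trunc ((K + K) / d)).+2.
have tL x : t x + 1 <= L%:R.
  rewrite /L -natr1 lerD2r ltW//; apply: le_lt_trans (truncnS_gt _).
  rewrite ler_pM2r ?invr_gt0// lerD2r.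
  exact: le_trans (ler_norm _) (le_unif_norm compX F x).
pose h i : C := cmax 0 (cmin 1 (d^-1 *: (F + K *: (1 : C)) + (1 - i%:R) *: (1 :
  C))).
have hE i x : h i x = Num.max 0 (Num.min 1 (t x + 1 - i%:R)).
  rewrite -[LHS]/(Num.max 0 (Num.min 1
    (d^-1 * (F x + K * 1) + (1 - i%:R) * 1))).
  by congr (Num.max _ (Num.min _ _)); rewrite /t; ring.
pose g (i : nat) : C := h i - h i.+1.
have gE i x : g i x = Num.max 0 (Num.min 1 (t x + 1 - i%:R))
    - Num.max 0 (Num.min 1 (t x - i%:R)).
  by rewrite [LHS]ctsE ctsE !hE -[i.+1%:R]natr1 opprD addrA addrAC addrK.
exists [seq g i | i <- iota 0 L]; split; last first.
  rewrite big_map -[L in iota 0 L]subn0 -/(index_iota 0 L).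
  rewrite (telescope_sumr_eq (fun i => - h i)) => // [|k _]; last first.
    by rewrite opprK addrC.
  apply: cts_ext => x; rewrite opprK addrC !ctsE !hE subr0.
  rewrite min_l; last by have := t0 x; lra.
  have tLx := tL x; rewrite (max_r ler01) min_r; last by lra.
  by rewrite max_l ?subr0//; lra.
move=> _ /mapP[i _ ->]; have g0 x : 0 <= g i x.
  rewrite gE; have : t x - i%:R <= t x + 1 - i%:R by lra.
  move: (t x - i%:R) (t x + 1 - i%:R) => a b ab.
  case: (leP 1 a) => ?; case: (leP 1 b) => ?; rewrite ?(max_r ler01);
    by case: (leP 0 a) => ?; case: (leP 0 b) => ?; lra.
(* [g i] vanishes unless [i - 1 < t < i + 1], where [F] lies between this constant and the constant
   plus [2 * d = e]. *)
split=> //; exists ((i%:R - 1) * d - K) => x.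
have [H|H] := leP (t x + 1 - i%:R) 0.
  have -> : g i x = 0.
    rewrite gE min_r; last by lra.
    by rewrite max_l// min_r ?max_l ?subrr//; lra.
  by rewrite !mulr0 lexx.
have [H'|H'] := leP 1 (t x - i%:R).
  have -> : g i x = 0 by rewrite gE !min_l ?subrr//; lra.
  by rewrite !mulr0 lexx.
by apply/andP; split; apply: ler_wpM2r => //; rewrite FE /d; nra.
Qed.

End partitions.

(** * Jensen bound for tau_n by the norm of A^n phi *)

Section lower_bound.
Context (R : realType) (X : ptopologicalType).
Hypothesis compX : compact [set: X].
Local Notation C := (continuousType X R).
Variables (alpha : continuousType X X) (A : {linear C -> C}).
Hypothesis transA : is_transfer_operator alpha A.
Variables (mu : {scalar C}) (smu : states mu).

(** On each member [g] of a fine partition ln phi lies between [c g] and [c g + e]. Hence mu(ln phi)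
    <= sum of mu(g) c(g), plus [e], and exp(c(g)) g <= phi g; [entropy_sum_le] links the two. *)
Lemma tau_n_le n (phi : C) (phi0 : forall x, 0 < phi x) :
  ((mu (cln phi0))%:E + tau_n A n mu <= lne (unif_norm (iter n A phi))%:E)%E.
Proof.
apply/lee_addgt0Pr => e e0.
have [D PD Dc] := fine_partition compX (cln phi0) e0.
have [D0 D1] := PD.
pose B := lin_iter A n.
have Bpos : positive B := lin_iter_pos n (transfer_pos transA).
have /choice[c cP] (g : C) : exists c : R, g \in D ->
    forall x, c * g x <= cln phi0 x * g x <= (c + e) * g x.
  have [/Dc[c cP]|_] := boolP (g \in D); first by exists c.
  by exists 0.
apply: (@le_trans _ _ ((mu (cln phi0))%:E + tau_part A n mu D)%E).
  by rewrite leeD2l//; apply: ereal_inf_lbound; exists D.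
rewrite addeC -leeBrDr//; apply: ge_ereal_sup => _ [m sm <-].
rewrite leeBrDr//.
have muF : mu (cln phi0) <= \sum_(g <- D) mu g * c g + e.
  rewrite -[cln phi0]mul1r -D1 mulr_suml (state_sum mu).
  have -> : \sum_(g <- D) mu g * c g + e = \sum_(g <- D) mu ((c g + e) *: g).
    rewrite -[X in _ + X]mulr1 -(state1 smu) -D1 (state_sum mu) mulr_sumr.
    by rewrite -big_split/=; apply: eq_bigr => g _; rewrite (stateZ mu); ring.
  rewrite big_seq [leRHS]big_seq; apply: ler_sum => g gD.
  apply: (state_le smu) => x; rewrite !ctsE mulrC.
  by have /andP[] := cP g gD x.
have mu0 g : g \in D -> 0 <= mu g by move=> /D0 /(state_ge0 smu).
have mB0 g : g \in D -> 0 <= m (iter n A g).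
  by move=> gD; apply: (state_ge0 sm); exact: (Bpos g (D0 g gD)).
have mu1 : \sum_(g <- D) mu g = 1 by rewrite -(state_sum mu) D1 (state1 smu).
have := entropy_sum_le (p := mu : C -> R) mu0 c mu1 mB0.
set ent := (X in (_ <= X -> _)%E) => H.
rewrite -/(entropy_sum D (mu : C -> R) (fun g => m (iter n A g))).
apply: (@le_trans _ _ (entropy_sum D (mu : C -> R) (fun g => m (iter n A g)) +
    (\sum_(g <- D) mu g * c g)%:E + e%:E)%E).
  by rewrite -addeA leeD2l// -EFinD lee_fin.
rewrite leeD2r//; apply: le_trans H _; apply: le_lne_EFin.
apply: (@le_trans _ _ (m (B phi))); last first.
  exact: le_trans (ler_norm _) (le_trans (state_norm compX sm _) (lexx _)).
have -> : phi = \sum_(g <- D) g * phi by rewrite -mulr_suml D1 mul1r.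
rewrite raddf_sum (state_sum m) big_seq [leRHS]big_seq; apply: ler_sum => g gD.
have -> : expR (c g) * m (iter n A g) = m (B (expR (c g) *: g)).
  by rewrite linearZ (stateZ m).
apply: (state_le sm); apply: (pos_le Bpos) => x; rewrite !ctsE mulrC.
have [->|gx0] := eqVneq (g x) 0; first by rewrite !mul0r.
have {}gx0 : 0 < g x by rewrite lt_neqAle eq_sym gx0 D0.
rewrite ler_pM2l// -[leRHS]lnK ?posrE// ler_expR -(ler_pM2r gx0).
by have /andP[] := cP g gD x.
Qed.

End lower_bound.

(** * The inequality mu(ln psi) + tau(mu) <= l(psi) for invariant states *)

Section invariant_lower_bound.
Context (R : realType) (X : ptopologicalType).
Hypotheses (hausX : hausdorff_space X) (compX : compact [set: X]).
Local Notation C := (continuousType X R).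
Variables (alpha : continuousType X X) (A : {linear C -> C}).
Hypothesis transA : is_transfer_operator alpha A.

Lemma invariant_bsum (mu : {scalar C}) n f : invariant_states alpha mu ->
  mu (bsum alpha n f) = n%:R * mu f.
Proof.
move=> [_ inv]; rewrite /bsum (state_sum mu) -[n in RHS]card_ord -sumr_const.
rewrite mulr_suml; apply: eq_bigr => -[k /= _] _; rewrite mul1r.
by elim: k => //= k <-; rewrite inv.
Qed.

Lemma bprod_gt0 n (f : C) : (forall x, 0 < f x) ->
  forall x, 0 < bprod alpha n f x.
Proof. by move=> f0 x; rewrite bprodE; apply: prodr_gt0. Qed.

Lemma cln_bprod n (f : C) (f0 : forall x, 0 < f x) :
  cln (bprod_gt0 n f0) = bsum alpha n (cln f0).
Proof.
apply: cts_ext => x; rewrite bsumE -[LHS]/(ln (bprod alpha n f x)) bprodE.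
elim: n => [|n IH]; first by rewrite !big_ord0 ln1.
by rewrite !big_ord_recr/= -IH lnM ?posrE ?prodr_gt0.
Qed.

Lemma bprodSr n (f : C) x :
  bprod alpha n.+1 f x = bprod alpha n f x * f (iter n alpha x).
Proof. by rewrite !bprodE big_ord_recr. Qed.

Variables (psi : C) (psi0 : nonneg psi).

(** The excess of (psi + d)_n over psi_n is at most linear in [d], uniformly on X, which allows [d]
    to be sent to 0 under A^n. *)
Lemma bprod_perturb n : exists2 K : R, 0 <= K & forall d : R, 0 <= d <= 1 ->
  forall x, bprod alpha n (psi + d *: (1 : C)) x <= bprod alpha n psi x + d * K.
Proof.
pose N := unif_norm psi.
have pN x : psi x <= N.
  by apply: le_trans (ler_norm _) _; exact: (le_unif_norm compX).
have N0 : 0 <= N := unif_norm_ge0 compX psi.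
elim: n => [|n [K K0 IH]].
  exists 0 => // d _ x; rewrite !bprodE !big_ord0 mulr0 addr0//.
exists (unif_norm (bprod alpha n psi) + K * (N + 1)).
  by rewrite addr_ge0 ?mulr_ge0 ?addr_ge0//; exact: unif_norm_ge0.
move=> d /andP[d0 d1] x; rewrite !bprodSr !ctsE mulr1.
have := IH d; rewrite d0 d1 => /(_ isT x).
have px := psi0 (iter n alpha x); have pxN := pN (iter n alpha x).
have b0 : 0 <= bprod alpha n psi x by exact: bprod_ge0.
have bN : bprod alpha n psi x <= unif_norm (bprod alpha n psi).
  by apply: le_trans (ler_norm _) _; exact: (le_unif_norm compX).
move: (bprod alpha n (psi + d *: (1 : C)) x) (bprod alpha n psi x) b0 bN => a b
  b0 bN.
move: (unif_norm _) bN => M bM ab.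
apply: (@le_trans _ _ ((b + d * K) * (psi (iter n alpha x) + d))).
  by rewrite ler_wpM2r// addr_ge0.
move: (psi (iter n alpha x)) px pxN => p p0 pN'.
have -> : (b + d * K) * (p + d) = b * p + d * (b + K * (p + d)) by ring.
by rewrite lerD2l ler_wpM2l// lerD// ler_wpM2l// lerD.
Qed.

Lemma le_lne_limit (r x K : R) : 0 <= K ->
  (forall d : R, 0 < d <= 1 -> (r%:E <= lne (x + d * K)%:E)%E) ->
  (r%:E <= lne x%:E)%E.
Proof.
move=> K0 H; have rx d : 0 < d <= 1 -> expR r <= x + d * K.
  move=> d01; have := H d d01; have [y0|y0] := leP (x + d * K) 0.
    by rewrite le0_lneNy ?lee_fin// leeNy_eq.
  by rewrite lne_EFin// lee_fin => ?; rewrite -[leRHS]lnK ?posrE// ler_expR.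
have {}rx : expR r <= x.
  apply/ler_addgt0Pr => e e0; pose d := Num.min 1 (e / (K + 1)).
  have K10 : 0 < K + 1 by rewrite ltr_wpDl.
  have d0 : 0 < d by rewrite lt_min ltr01 divr_gt0.
  apply: le_trans (rx d _) _; first by rewrite d0 ge_min lexx.
  rewrite lerD2l; apply: (@le_trans _ _ (e / (K + 1) * K)).
    by rewrite ler_wpM2r// ge_min lexx orbT.
  rewrite mulrAC ler_pdivrMr// ler_wpM2l// ?ltW//.
  by rewrite ltrDl.
have x0 : 0 < x := lt_le_trans (expR_gt0 r) rx.
by rewrite lne_EFin// lee_fin -ler_expR lnK ?posrE.
Qed.

Lemma variational_le (mu : {scalar C}) : invariant_states alpha mu ->
  (integral_ln psi mu + t_entropy A mu
      <= log_spectral_radius (weighted A psi))%E.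
Proof.
move=> imu; have smu : states mu by case: imu.
rewrite (spectral_radius_weighted transA compX psi0).
apply: le_ereal_inf_tmp => _ [n n0 <-].
have n0R : (0 : R) < n%:R by rewrite ltr0n.
set a := unif_norm _.
have tau_le : (t_entropy A mu <= (n%:R^-1)%:E * tau_n A n mu)%E.
  by apply: ereal_inf_lbound; exists n.
apply: le_trans (leeD2l _ tau_le) _.
have iln := integral_ln_le hausX compX smu psi0.
case E : (integral_ln psi mu) iln => [i| |] iln; last by rewrite addNye leNye.
- case T : (tau_n A n mu) => [t| |].
  + rewrite -EFinM -EFinD; suff : ((n%:R * i + t)%:E <= lne a%:E)%E.
      have ninv0 : (0 <= (n%:R^-1 : R)%:E)%E by rewrite lee_fin invr_ge0 ltW.
      move=> H; apply: le_trans (lee_wpmul2l ninv0 H).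
      by rewrite -EFinM mulrDr mulrA mulVf ?gt_eqF// mul1r.
    have [K K0 HK] := bprod_perturb n.
    (* By positivity A^n (psi + d)_n <= A^n psi_n + d K A^n 1, whence the slope in [d]. *)
    apply: (@le_lne_limit _ _ (K * unif_norm (iter n A 1))).
      by rewrite mulr_ge0//; exact: unif_norm_ge0.
    move=> d /andP[d0 d1].
    have := tau_n_le compX transA smu n (bprod_gt0 n (add_cst_gt0 psi0 d0)).
    rewrite cln_bprod (invariant_bsum n _ imu) T -EFinD => H.
    apply: (@le_trans _ _ ((n%:R * mu (cln (add_cst_gt0 psi0 d0)) + t)%:E)).
      by rewrite lee_fin lerD2r ler_wpM2l ?(ltW n0R)// -lee_fin iln.
    apply: (le_trans H); apply: le_lne_EFin.
    pose B := lin_iter A n.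
    have Bpos : positive B := lin_iter_pos n (transfer_pos transA).
    apply: unif_norm_le => // x; rewrite ger0_norm; last first.
      by apply: (Bpos (bprod alpha n _)) => y; exact/ltW/bprod_gt0/add_cst_gt0.
    apply: (@le_trans _ _ (B (bprod alpha n psi + (d * K) *: (1 : C)) x)).
      apply: (pos_le Bpos) => y; rewrite !ctsE mulr1; apply: HK.
      by rewrite ltW.
    rewrite linearD linearZ !ctsE mulrA; apply: lerD.
      exact: le_trans (ler_norm _) (le_unif_norm compX _ x).
    rewrite ler_wpM2l ?mulr_ge0 ?(ltW d0)//.
    exact: le_trans (ler_norm _) (le_unif_norm compX _ x).
  (* The value +oo of [tau_n] is excluded by the same bound at [d = 1]. *)
  + have := tau_n_le compX transA smu n
      (bprod_gt0 n (add_cst_gt0 psi0 ltr01)).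
    rewrite T addey// leye_eq.
    set b := unif_norm _.
    by have [b0|b0] := leP b 0; [rewrite le0_lneNy ?lee_fin|rewrite lne_EFin].
  + by rewrite mulr_infty gtr0_sg ?invr_gt0// mul1e addeNy leNye.
- by have := iln 1 ltr01; rewrite leye_eq.
Qed.

End invariant_lower_bound.

(** * Equilibrium states *)

Section invariant_limits.
Context (R : realType) (X : ptopologicalType).
Hypothesis compX : compact [set: X].
Local Notation C := (continuousType X R).
Variable alpha : continuousType X X.

(** The exponential lies above its tangent line at [mu f]. *)
Lemma state_jensen_exp (mu : {scalar C}) (smu : states mu) f :
  expR (mu f) <= mu (cexp f).
Proof.
have -> : expR (mu f) = mu (expR (mu f) *: (f + (1 - mu f) *: (1 : C))).
  by rewrite (stateZ mu) (stateD mu) (state_cst smu) addrC subrK mulr1.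
apply: (state_le smu) => x; rewrite !ctsE mulr1.
rewrite -[cexp f x]/(expR (f x)) -[in leRHS](subrKC (mu f) (f x)) expRD.
rewrite ler_wpM2l ?expR_ge0//; apply: le_trans (expR_ge1Dx _); lra.
Qed.

Lemma bsum_linear n : linear (bsum alpha n : C -> C).
Proof.
move=> a f g; apply: cts_ext => x; rewrite !ctsE !bsumE mulr_sumr -big_split/=.
by apply: eq_bigr.
Qed.

Lemma bsum1 n : bsum alpha n (1 : C) = n%:R *: (1 : C).
Proof.
apply: cts_ext => x; rewrite bsumE !ctsE mulr1 -[n in RHS]card_ord -sumr_const.
by apply: eq_bigr.
Qed.

Lemma bsum_coboundary n (f : C) :
  bsum alpha n (f \o alpha : C) - bsum alpha n f = shift alpha n f - f.
Proof.
apply: cts_ext => x; rewrite !ctsE !bsumE shiftE.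
rewrite -(big_mkord xpredT (fun k => (f \o alpha : C) (iter k alpha x))).
rewrite -(big_mkord xpredT (fun k => f (iter k alpha x))) -sumrB.
by rewrite (telescope_sumr (fun k => f (iter k alpha x))).
Qed.

(** A Krylov-Bogoliubov construction: [mu] is an ultralimit of the averages of [rho n] along orbits,
    so eventual upper bounds on these averages pass to [mu]. *)
Lemma invariant_limit (rho : nat -> {scalar C}) :
  (forall n, states (rho n)) ->
  exists2 mu : {scalar C}, invariant_states alpha mu &
    forall (f : C) (b : R), (forall e, 0 < e -> \forall n \near \oo,
      rho n (bsum alpha n f) <= n%:R * (b + e)) -> mu f <= b.
Proof.
move=> srho; have [U UU ooU] := ultrafilter_ex.
(* The index is shifted by one so that every [F n] is a state; at 0 the average would be zero. *)
pose F n (f : C) : R := n.+1%:R^-1 * rho n.+1 (bsum alpha n.+1 f).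
have nR0 n : (0 : R) < n.+1%:R by rewrite ltr0n.
have lF n : scalar (F n).
  move=> a f g; rewrite /F bsum_linear (stateD (rho n.+1)) (stateZ (rho n.+1)).
  by rewrite mulrDr mulrCA.
pose m n := mkscalar (lF n).
have mE n f : m n f = F n f by [].
have sm n : states (m n).
  split=> [f f0|]; rewrite mE /F.
    rewrite mulr_ge0 ?invr_ge0 ?ler0n//; apply: (state_ge0 (srho _)) => x.
    by rewrite bsumE sumr_ge0.
  by rewrite bsum1 (state_cst (srho _)) mulVf ?gt_eqF.
have [mu smu mucvg] := state_ultra_cvg compX UU sm.
have mu_le (f : C) (b : R) : (forall e, 0 < e -> \forall n \near \oo,
      rho n (bsum alpha n f) <= n%:R * (b + e)) -> mu f <= b.
  move=> H; apply/ler_addgt0Pr => e /H He;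
    apply: (@cvgr_to_le nat U _ R (fun n => m n f)).
    exact: mucvg.
  apply: ooU; case: He => k _ Hk; exists k => // n /= kn.
  rewrite -[leLHS]/(F n f) /F mulrC ler_pdivrMr// mulrC; apply: Hk => /=.
  exact: leq_trans kn (leqnSn n).
exists mu => //; split => //.
(* The Birkhoff sum of a coboundary telescopes and stays below 2|f|, so its averages tend to 0.
   Using [- f] as well gives invariance. *)
have mu_inv (f : C) : mu ((f \o alpha : C) - f) <= 0.
  apply: mu_le => e e0;
    exists (Num.trunc (2 * unif_norm f / e)).+1 => // n /= kn.
  have -> : bsum alpha n ((f \o alpha : C) - f) = shift alpha n f - f.
    rewrite -bsum_coboundary -[- f]scaleN1r addrC bsum_linear.
    by rewrite scaleN1r addrC.
  rewrite add0r; apply: (@le_trans _ _ (2 * unif_norm f)).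
    apply: (state_le_cst (srho n)) => x; rewrite !ctsE shiftE.
    have := le_unif_norm compX f (iter n alpha x).
    have := le_unif_norm compX f x.
    by rewrite !ler_norml => /andP[? ?] /andP[? ?]; lra.
  rewrite -ler_pdivrMr// ltW//; apply: lt_le_trans (truncnS_gt _) _.
  by rewrite ler_nat.
move=> f; apply/eqP; rewrite eq_le -subr_le0 -(stateB mu) mu_inv/=.
have := mu_inv (- f); rewrite (stateB mu) (stateN mu) opprK.
have -> : (- f \o alpha : C) = - (f \o alpha : C) by exact: cts_ext.
by rewrite (stateN mu) addrC subr_le0.
Qed.

End invariant_limits.

(** * Growth of A^n along Birkhoff products of a test weight *)

Section test_weights.
Context (R : realType) (X : ptopologicalType).
Hypothesis compX : compact [set: X].
Local Notation C := (continuousType X R).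
Variables (alpha : continuousType X X) (A : {linear C -> C}).
Hypothesis transA : is_transfer_operator alpha A.

(** alpha^n as a continuous map, over which A^n is again a transfer operator. *)
Fixpoint citer n : continuousType X X :=
  if n is k.+1 then (alpha \o citer k : continuousType X X) else idfun.

Lemma citerE n x : citer n x = iter n alpha x.
Proof. by elim: n => //= n ->. Qed.

Lemma shift_citer n (f : C) : (f \o citer n : C) = shift alpha n f.
Proof. by apply: cts_ext => x; rewrite shiftE -citerE. Qed.

Lemma lin_iter_transfer n : is_transfer_operator (citer n) (lin_iter A n).
Proof.
split=> [|f g]; first exact: (lin_iter_pos n (transfer_pos transA)).
by rewrite shift_citer; exact: iter_transfer.
Qed.

Lemma unif_norm_iter_le (B : {linear C -> C}) n : positive B ->
  unif_norm (iter n B 1) <= unif_norm (B 1) ^+ n.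
Proof.
move=> Bpos; elim: n => [|n IH].
  by rewrite expr0; apply: unif_norm_le => // x; rewrite normr1.
rewrite iterS exprSr; apply: le_trans (unif_norm_pos_le compX Bpos _) _.
by rewrite ler_wpM2r// unif_norm_ge0.
Qed.

Lemma sum_residues (F : nat -> R) q N :
  \sum_(k < q * N) F k = \sum_(j < N) \sum_(i < q) F (j + i * N)%N.
Proof.
elim: q => [|q IH].
  by rewrite mul0n big_ord0 big1// => j _; rewrite big_ord0.
rewrite mulSnr big_split_ord/= IH -big_split/=.
by apply: eq_bigr => j _; rewrite big_ord_recr/= addnC.
Qed.

Variables (N : nat) (Psi : C) (Psi0 : forall x, 0 < Psi x).
Hypothesis N0 : (0 < N)%N.

Let phi : C := N%:R^-1 *: cln Psi0.
Let w := unif_norm (iter N A Psi).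
Let Phi q := bprod (citer N) q Psi.

Let NR0 : (0 : R) < N%:R. Proof. by rewrite ltr0n. Qed.

Let Phi_ge0 q : nonneg (Phi q).
Proof. by apply: bprod_ge0 => x; exact: ltW. Qed.

(* AM-GM applied to the [N] residue classes of the time steps. *)
Let exp_bsum_le q x : expR (bsum alpha (q * N) phi x) <=
  N%:R^-1 * \sum_(j < N) shift alpha j (Phi q) x.
Proof.
pose y j := \sum_(i < q) ln (Psi (iter (j + i * N) alpha x)).
have -> : bsum alpha (q * N) phi x = N%:R^-1 * \sum_(j < N) y j.
  rewrite bsumE (sum_residues (fun k => phi (iter k alpha x))) mulr_sumr.
  by apply: eq_bigr => j _; rewrite /y mulr_sumr.
have PhiE j : shift alpha j (Phi q) x = expR (y j).
  rewrite shiftE /Phi bprodE /y expR_sum; apply: eq_bigr => i _.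
  rewrite lnK ?posrE// addnC iterD; congr (Psi _).
  move: (iter j alpha x) => z; elim: (i : nat) => [//|k IH].
  by rewrite iterS IH citerE -iterD.
under [in leRHS]eq_bigr do rewrite PhiE.
set c := N%:R^-1 * _.
rewrite mulrC ler_pdivlMr//.
apply: (@le_trans _ _ (\sum_(j < N) expR c * (1 + (y j - c)))).
  rewrite -mulr_sumr ler_wpM2l ?expR_ge0// big_split/= sumrB !sumr_const
    card_ord.
  have -> : \sum_(i < N) y i = c * N%:R by rewrite /c mulrC mulrA divff
    ?gt_eqF// mul1r.
  by rewrite -[c *+ _]mulr_natr subrr addr0.
apply: ler_sum => j _; rewrite -[in leRHS](subrKC c (y j)) expRD.
by rewrite ler_wpM2l ?expR_ge0// expR_ge1Dx.
Qed.

(** [Phi q] is the Birkhoff product of [Psi] along alpha^N, so A^(qN) (Phi q) is the q-th iterate of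
    f |-> A^N (Psi f) at 1. *)
Let unif_norm_Phi q : unif_norm (iter (q * N) A (Phi q)) <= w ^+ q.
Proof.
have tN := lin_iter_transfer N.
have := @unif_norm_iter_le (weighted_lin (lin_iter A N) Psi) q.
have -> : weighted_lin (lin_iter A N) Psi 1 = iter N A Psi.
  by rewrite -[LHS]/(iter N A (Psi * 1)) mulr1.
have -> : iter q (weighted_lin (lin_iter A N) Psi) 1 = iter (q * N) A (Phi q).
  rewrite -[LHS]/(iter q (weighted (lin_iter A N) Psi) 1).
  by rewrite (iter_weighted tN) mulr1 iterM.
apply=> f f0; apply: (lin_iter_pos N (transfer_pos transA)) => x.
by rewrite ctsE mulr_ge0// ltW.
Qed.

(** The AM-GM bound covers the first [q * N] time steps and the other [r] cost a bounded factor.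
    Taking [N <= r] ensures that every shift [j < N] can be absorbed by [j] of the iterates of
    [A]. *)
Lemma unif_norm_bprod_exp_le : exists2 K, 0 < K & forall q r : nat,
  (N <= r < 2 * N)%N ->
  unif_norm (iter (r + q * N) A (bprod alpha (r + q * N) (cexp phi))) <= K * w
    ^+ q.
Proof.
pose M := 1 + \sum_(i < 2 * N) unif_norm (iter i A 1).
have M0 : 0 < M by rewrite ltr_pwDl// sumr_ge0// => i _; exact: unif_norm_ge0.
have MP i x : (i < 2 * N)%N -> iter i A 1 x <= M.
  move=> iN; apply: le_trans (ler_norm _) _;
    apply: le_trans (le_unif_norm compX _ _) _.
  rewrite /M (bigD1 (Ordinal iN))//= addrCA lerDl addr_ge0// sumr_ge0// => j _.
  exact: unif_norm_ge0.
pose L := unif_norm phi; have L0 : 0 <= L := unif_norm_ge0 compX phi.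
(* The exponential bounds the last [r] terms of the Birkhoff sum; one [M] bounds A^j 1 and the other
   A^(r-j) 1. *)
exists (expR ((2 * N)%:R * L) * (M * M)); first by rewrite !mulr_gt0 ?expR_gt0.
move=> q r /andP[Nr rN].
have Apos n : positive (lin_iter A n) := lin_iter_pos n (transfer_pos transA).
have b0 n : nonneg (bprod alpha n (cexp phi)).
  by apply: bprod_ge0 => x; exact: expR_ge0.
apply: unif_norm_le => // x; rewrite ger0_norm; last exact: (Apos _ _ (b0 _)).
pose G : C := (expR ((2 * N)%:R * L) * N%:R^-1) *: \sum_(j < N) shift alpha j
  (Phi q).
apply: (@le_trans _ _ (lin_iter A (r + q * N) G x)).
  apply: (pos_le (Apos _)) => y; rewrite bprod_exp.
  have -> : bsum alpha (r + q * N) phi y = bsum alpha (q * N) phi y +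
      \sum_(k < r) phi (iter (q * N + k) alpha y).
    by rewrite !bsumE addnC big_split_ord.
  rewrite /G ctsZE expRD mulrC -mulrA; apply: ler_pM; rewrite ?expR_ge0//.
    rewrite ler_expR; apply: (@le_trans _ _ (\sum_(k < r) L)).
      apply: ler_sum => k _; apply: le_trans (ler_norm _) _.
      exact: (le_unif_norm compX).
    by rewrite sumr_const card_ord -[leLHS]mulr_natl ler_wpM2r// ler_nat ltnW.
  by rewrite [X in _ * X]cts_sumE; exact: exp_bsum_le.

have -> : lin_iter A (r + q * N) G x = expR ((2 * N)%:R * L) * N%:R^-1 *
    \sum_(j < N) lin_iter A (r + q * N) (shift alpha j (Phi q)) x.
  by rewrite /G linearZ ctsZE raddf_sum cts_sumE.
rewrite -!mulrA ler_wpM2l ?expR_ge0//.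
rewrite mulrC ler_pdivrMr//.
have -> : M * (M * w ^+ q) * N%:R = \sum_(j < N) M * (M * w ^+ q).
  by rewrite sumr_const card_ord mulr_natr.
apply: ler_sum => j _.
have jr : (j <= r)%N by apply: leq_trans Nr; exact: ltnW.
have -> : lin_iter A (r + q * N) (shift alpha j (Phi q)) =
    lin_iter A (r + q * N - j) (Phi q * iter j A 1).
  rewrite -[LHS]/(iter (r + q * N) A (shift alpha j (Phi q))).
  rewrite -(iter_transfer transA) mulr1 -[RHS]/(iter _ A (iter j A _)) -iterD.
  by rewrite subnK// (leq_trans jr)// leq_addr.
apply: (@le_trans _ _ (lin_iter A (r + q * N - j) (M *: Phi q) x)).
  apply: (pos_le (Apos _)) => y; rewrite !ctsE mulrC ler_wpM2r//;
    first exact: Phi_ge0.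
  by apply: MP; apply: leq_ltn_trans rN.
rewrite linearZ ctsE ler_wpM2l ?(ltW M0)//.
rewrite -[lin_iter A _ _]/(iter _ A (Phi q)) -addnC -addnBA// addnC iterD.
apply: le_trans (ler_norm _) _.
apply: le_trans (pos_norm compX (Apos (r - j)%N) _ x) _.
rewrite mulrC; apply: ler_pM.
- by apply: (Apos _ 1) => y; rewrite ctsE.
- exact: unif_norm_ge0.
- by apply: MP; apply: leq_ltn_trans rN; exact: leq_subr.
- exact: unif_norm_Phi.
Qed.

End test_weights.

(** * Construction of the equilibrium state *)

Section equilibrium_state.
Context (R : realType) (X : ptopologicalType).
Hypothesis compX : compact [set: X].
Local Notation C := (continuousType X R).
Variables (alpha : continuousType X X) (A : {linear C -> C}).
Hypothesis transA : is_transfer_operator alpha A.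
Variables (psi : C) (psi0 : nonneg psi).

Let a n := unif_norm (iter n A (bprod alpha n psi)).
Hypothesis a_gt0 : forall n, 0 < a n.

Let x_ n : X := sval (cid (unif_norm_attained compX
  (lin_iter_pos n (transfer_pos transA) (bprod_ge0 alpha n psi0)))).

Let x_P n : iter n A (bprod alpha n psi) (x_ n) = a n.
Proof. by rewrite /x_; case: cid. Qed.

Let rho_fun n (f : C) : R := (a n)^-1 * iter n A (bprod alpha n psi * f) (x_ n).

Let rho_scalar n : scalar (rho_fun n).
Proof.
move=> c f g; rewrite /rho_fun.
have -> : bprod alpha n psi * (c *: f + g) =
    c *: (bprod alpha n psi * f) + bprod alpha n psi * g.
  by apply: cts_ext => x; rewrite !ctsE mulrDr mulrCA.
by rewrite iter_linear !ctsE mulrDr mulrCA.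
Qed.

Let rho n := mkscalar (rho_scalar n).

Let rho_state n : states (rho n).
Proof.
split=> [f f0|]; rewrite -[rho n _]/(rho_fun n _) /rho_fun.
  rewrite mulr_ge0 ?invr_ge0 ?(ltW (a_gt0 n))//.
  apply: (lin_iter_pos n (transfer_pos transA)) => x.
  by rewrite ctsE mulr_ge0// bprod_ge0.
by rewrite mulr1 x_P mulVf ?gt_eqF.
Qed.

(** Jensen's inequality moves the exponential inside [rho n]; there psi_n times the exponential is a
    product of factors exp(phi) psi / (psi + d) <= exp(phi). *)
Let rho_le n (phi : C) (d : R) (d0 : 0 < d) :
  a n * expR (rho n (bsum alpha n (phi - cln (add_cst_gt0 psi0 d0)))) <=
  unif_norm (iter n A (bprod alpha n (cexp phi))).
Proof.
set f := phi - _; have Apos := lin_iter_pos n (transfer_pos transA).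
apply: (@le_trans _ _ (a n * rho n (cexp (bsum alpha n f)))).
  by rewrite ler_wpM2l ?(ltW (a_gt0 n))// state_jensen_exp.
rewrite -[rho n _]/(rho_fun n _) /rho_fun mulrA divff ?gt_eqF// mul1r.
apply: (@le_trans _ _ (iter n A (bprod alpha n (cexp phi)) (x_ n))); last first.
  by apply: le_trans (ler_norm _) _; exact: (le_unif_norm compX).
apply: (pos_le Apos) => x; rewrite ctsE.
rewrite -[cexp _ x]/(expR _) -bprod_exp !bprodE -big_split/=.
apply: ler_prod => k _; set y := iter k alpha x.
rewrite mulr_ge0 ?expR_ge0//=.
rewrite -[X in _ * expR X]/(phi y - ln (psi y + d * 1)) mulr1.
have pd : 0 < psi y + d by rewrite ltr_wpDl.
rewrite expRD expRN lnK ?posrE// mulrCA ler_piMr ?expR_ge0//.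
by rewrite ler_pdivrMr// mul1r lerDl ltW.
Qed.

Lemma equilibrium_state_ex (c : R) :
  (forall n, (0 < n)%N -> n%:R * c <= ln (a n)) ->
  exists2 mu, invariant_states alpha mu &
    forall (N : nat) (Psi : C) (Psi0 : forall x, 0 < Psi x)
      (d : R) (d0 : 0 < d), (0 < N)%N ->
    0 < unif_norm (iter N A Psi) /\
    N%:R * (c - mu (cln (add_cst_gt0 psi0 d0))) + mu (cln Psi0)
      <= ln (unif_norm (iter N A Psi)).
Proof.
move=> ca; have [mu imu mu_le] := invariant_limit compX alpha rho_state.
exists mu => // N Psi Psi0 d d0 N0.
have NR0 : (0 : R) < N%:R by rewrite ltr0n.
set w := unif_norm _; have w_ge0 : 0 <= w := unif_norm_ge0 compX _.
pose phi : C := N%:R^-1 *: cln Psi0.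
pose f := phi - cln (add_cst_gt0 psi0 d0).
have [K K0 HK] := unif_norm_bprod_exp_le compX transA Psi0 N0.
have {}HK n : (2 * N <= n)%N -> exists2 q : nat,
    (0 < q)%N /\ (n < (q + 2) * N)%N /\ (q * N <= n)%N &
    a n * expR (rho n (bsum alpha n f)) <= K * w ^+ q.
  (* One block fewer than the quotient puts the remainder [n - q * N] between [N] and [2 * N]. *)
  move=> Nn; pose q := (n %/ N).-1.
  have q1 : (2 <= n %/ N)%N by rewrite leq_divRL.
  have qE : (n %/ N = q.+1)%N by rewrite /q prednK// ltnW.
  have nE := divn_eq n N; have rN := ltn_pmod n N0.
  exists q; first by nia.
  apply: le_trans (rho_le _ _ _) _.
  have -> : n = (n %% N + N + q * N)%N by nia.
  by apply: HK; nia.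
(* Since [q > 0], [w = 0] would make a positive quantity at most 0. *)
have w0 : 0 < w.
  rewrite lt_neqAle w_ge0 andbT eq_sym; apply/eqP => w0.
  have [q [q0 _]] := HK _ (leqnn _).
  by rewrite w0 expr0n gtn_eqF//= mulr0 leNgt mulr_gt0 ?expR_gt0.
split=> //.
have : mu f <= ln w / N%:R - c.
  apply: mu_le => e e0; pose k := (`|ln K| + 2 * `|ln w|) / e.
  exists (2 * N + (Num.trunc k).+1)%N => // n /= kn.
  have Nn : (2 * N <= n)%N by apply: leq_trans kn; exact: leq_addr.
  have n0 : (0 < n)%N by apply: leq_trans Nn; rewrite muln_gt0.
  have [q [_ [nq qn]] H] := HK n Nn.
  have {}H : ln (a n) + rho n (bsum alpha n f) <= ln K + q%:R * ln w.
    rewrite -[X in _ + X]expRK -lnM ?posrE ?expR_gt0//.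
    rewrite mulr_natl -lnXn// -lnM ?posrE ?exprn_gt0//.
    by rewrite ler_ln ?posrE ?mulr_gt0 ?expR_gt0 ?exprn_gt0.
  have {}ca := ca n n0.
  (* [ln w] may have either sign, so both q <= n/N and n/N <= q + 2 are used. *)
  have qlw : q%:R * ln w <= n%:R / N%:R * ln w + 2 * `|ln w|.
    have h1 : q%:R <= n%:R / N%:R :> R by rewrite ler_pdivlMr// -natrM ler_nat.
    have h2 : n%:R / N%:R <= q%:R + 2 :> R.
      by rewrite ler_pdivrMr// -natrD -natrM ler_nat ltnW.
    have := ler_norm (- ln w); rewrite normrN; have := ler_norm (ln w).
    have := normr_ge0 (ln w).
    move: (n%:R / N%:R) (q%:R : R) (ln w) `|ln w| h1 h2 => s t l m.
    by move=> *; nra.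
  have ke : `|ln K| + 2 * `|ln w| <= n%:R * e.
    rewrite -ler_pdivrMr// -/k ltW//; apply: lt_le_trans (truncnS_gt _) _.
    by rewrite ler_nat; apply: leq_trans kn; exact: leq_addl.
  have lnKn := ler_norm (ln K).
  have -> : n%:R * (ln w / N%:R - c + e) =
    n%:R / N%:R * ln w - n%:R * c + n%:R * e by ring.
  rewrite -[leLHS]/(rho n (bsum alpha n f)).
  move: H ca qlw ke lnKn;
    move: (rho n _) (ln (a n)) (ln K) `|ln K| (ln w) `|ln w|.
  by move=> *; lra.
rewrite /f /phi (stateB mu) (stateZ mu) -(ler_pM2l NR0).
have -> : N%:R * (ln w / N%:R - c) = ln w - N%:R * c.
  by rewrite mulrBr mulrCA divff ?gt_eqF// mulr1.
rewrite mulrBr mulrA divff ?gt_eqF// mul1r.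
move: (mu _) (mu _) => u v; rewrite mulrBr.
by move=> *; lra.
Qed.

End equilibrium_state.


(** * An optimal state for a given partition of unity *)

Section minimax.
Context (R : realType) (X : ptopologicalType).
Hypothesis compX : compact [set: X].
Local Notation C := (continuousType X R).
Variables (B : {linear C -> C}) (Bpos : positive B).
Variables (mu : {scalar C}) (smu : states mu) (D : {fset C}).
Hypothesis PD : partition_of_unity D.

Let D_ge0 g : g \in D -> nonneg g. Proof. exact: PD.1. Qed.

Let v (m : {scalar C}) g := m (B g).

Let v_ge0 m g : states m -> g \in D -> 0 <= v m g.
Proof. by move=> sm gD; apply: (state_ge0 sm); apply: Bpos; exact: D_ge0. Qed.

Let p_ge0 g : g \in D -> 0 <= mu g.
Proof. by move=> gD; apply: (state_ge0 smu); exact: D_ge0. Qed.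

Let p_sum1 : \sum_(g <- D) mu g = 1.
Proof. by rewrite -(state_sum mu) PD.2 (state1 smu). Qed.

(** The shift by [d] keeps the logarithms continuous when m(B g) tends to 0. *)
Let F d m := \sum_(g <- D) mu g * ln (v m g + d).

Let cvg_F T (U : set_system T) (UU : UltraFilter U) (m_ : T -> {scalar C}) m d :
  0 < d -> states m -> (forall f : C, m_ t f @[t --> U] --> m f) ->
  F d (m_ t) @[t --> U] --> F d m.
Proof.
move=> d0 sm mcvg; rewrite /F big_seq.
have -> : (fun t => \sum_(g <- D) mu g * ln (v (m_ t) g + d)) =
    (fun t => \sum_(g <- D | g \in D) mu g * ln (v (m_ t) g + d)).
  by apply/funext => t; rewrite big_seq.
apply: cvg_big => [|g gD]; first exact: add_continuous.
apply: cvgMl_tmp.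
apply: (@continuous_cvg _ _ _ U _ (fun t => v (m_ t) g + d) (@ln R)).
  by apply: continuous_ln; rewrite ltr_wpDl// v_ge0.
by apply: cvgD; [exact: mcvg|exact: cvg_cst].
Qed.

Let F_le d m : 0 < d -> states m ->
  F d m <= \sum_(g <- D) mu g * ln (unif_norm (B g) + d).
Proof.
move=> d0 sm; rewrite /F big_seq [leRHS]big_seq; apply: ler_sum => g gD.
rewrite ler_wpM2l ?p_ge0// ler_ln ?posrE ?ltr_wpDl ?v_ge0 ?unif_norm_ge0//.
by rewrite lerD2r (le_trans (ler_norm _))// (state_norm compX sm).
Qed.

Let F_max d : 0 < d ->
  exists2 m0, states m0 & forall m, states m -> F d m <= F d m0.
Proof.
move=> d0; pose S := [set F d m | m in @states X R].
have supS : has_sup S.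
  split; first by exists (F d (dirac_state R point)), (dirac_state R point) =>
    //; exact: dirac_stateP.
  by exists (\sum_(g <- D) mu g * ln (unif_norm (B g) + d)) => _ [m sm <-];
    exact: F_le.
have /choice[m_ m_P] n : exists m, states m /\ sup S - n.+1%:R^-1 < F d m.
  have n0 : (0 : R) < n.+1%:R^-1 by rewrite invr_gt0 ltr0n.
  by have [_ [m sm <-] H] := sup_adherent n0 supS; exists m.
have [U UU ooU] := ultrafilter_ex.
have [m0 sm0 m0cvg] := state_ultra_cvg compX UU (fun n => (m_P n).1).
exists m0 => // m sm; apply: (@le_trans _ _ (sup S)).
  by apply: ub_le_sup; [exact: supS.2|exists m].
apply/ler_addgt0Pr => e e0; rewrite -lerBlDr.
apply: (@cvgr_to_ge nat U _ R (fun n => F d (m_ n))); first exact: cvg_F.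
apply: ooU; exists (Num.trunc e^-1) => // n /= kn.
apply: le_trans (ltW (m_P n).2); rewrite lerD2l lerN2.
rewrite -[leRHS]invrK lef_pV2 ?posrE ?ltr0n ?invr_gt0// ltW//.
by apply: lt_le_trans (truncnS_gt _) _; rewrite ler_nat ltnS.
Qed.

(* First-order optimality at a maximizer of the concave function [F d]. *)
Let F_optimality d m0 : 0 < d -> states m0 ->
  (forall m, states m -> F d m <= F d m0) ->
  forall m, states m ->
  \sum_(g <- D) mu g * ((v m g + d) / (v m0 g + d)) <= 1.
Proof.
move=> d0 sm0 m0max m sm.
pose u g := v m g - v m0 g.
pose Q := \sum_(g <- D) mu g * (u g ^+ 2 / d ^+ 2).
have Q0 : 0 <= Q.
  rewrite /Q big_seq sumr_ge0// => g gD.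
  by rewrite mulr_ge0 ?p_ge0// divr_ge0 ?sqr_ge0.
(* Maximality is tested against (1 - t) m0 + t m. The left side is the directional derivative, and
   denominators of at least [d] bound the second-order error by [t * Q]. *)
have key t : 0 < t <= 1 -> \sum_(g <- D) mu g * (u g / (v m0 g + d)) <= t * Q.
  move=> /andP[t0 t1].
  have lmt : scalar (fun f => (1 - t) * m0 f + t * m f).
    move=> a f g; rewrite (stateD m0) (stateD m) (stateZ m0) (stateZ m); ring.
  pose mt := mkscalar lmt.
  have smt : states mt.
    split=> [f f0|]; rewrite -[mt _]/((1 - t) * m0 _ + t * m _).
      by rewrite addr_ge0// mulr_ge0 ?subr_ge0 ?(state_ge0 sm0) ?(state_ge0
        sm)// ltW.
    by rewrite (state1 sm) (state1 sm0) !mulr1 subrK.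
  have vt g : v mt g = v m0 g + t * u g.
    by rewrite /u -[LHS]/((1 - t) * v m0 g + t * v m g); ring.
  have : \sum_(g <- D) t * (mu g * (u g / (v m0 g + d) - t * (u g ^+ 2 / d ^+
    2)))
      <= F d mt - F d m0.
    rewrite /F -sumrB big_seq [leRHS]big_seq; apply: ler_sum => g gD.
    rewrite -mulrBr mulrCA ler_wpM2l ?p_ge0//.
    have a0 : 0 < v m0 g + d by rewrite ltr_wpDl ?v_ge0.
    have b0 : 0 < v mt g + d by rewrite ltr_wpDl ?v_ge0.
    apply: (@le_trans _ _ (1 - (v m0 g + d) / (v mt g + d))); last first.
      have := @le_ln1Dx R ((v m0 g + d) / (v mt g + d) - 1).
      rewrite subrKC ln_div ?posrE//.
      have : 0 < (v m0 g + d) / (v mt g + d) by rewrite divr_gt0.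
      by move=> h /(_ ltac:(lra)); lra.
    have -> : 1 - (v m0 g + d) / (v mt g + d) = t * (u g / (v mt g + d)).
      by rewrite vt; rewrite vt in b0; field; rewrite gt_eqF.
    rewrite ler_pM2l//.
    have -> : u g / (v mt g + d) = u g / (v m0 g + d) -
        t * (u g ^+ 2 / ((v m0 g + d) * (v mt g + d))).
      by rewrite vt; rewrite vt in b0; field; rewrite !gt_eqF.
    rewrite lerD2l lerN2 ler_pM2l// ler_wpM2l ?sqr_ge0//.
    rewrite lef_pV2 ?posrE ?mulr_gt0 ?exprn_gt0// expr2.
    by apply: ler_pM; rewrite ?(ltW d0)// lerDr v_ge0.
  have Fle : F d mt - F d m0 <= 0 by rewrite subr_le0; exact: m0max.
  rewrite -mulr_sumr => /le_trans/(_ Fle).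
  rewrite pmulr_rle0// => H; rewrite -subr_le0; apply: le_trans H.
  rewrite /Q mulr_sumr -sumrB le_eqVlt; apply/orP; left; apply/eqP.
  by apply: eq_bigr => g _; ring.
have -> : \sum_(g <- D) mu g * ((v m g + d) / (v m0 g + d)) =
    1 + \sum_(g <- D) mu g * (u g / (v m0 g + d)).
  rewrite -p_sum1 -big_split big_seq [RHS]big_seq; apply: eq_bigr => g gD /=.
  have a0 : 0 < v m0 g + d by rewrite ltr_wpDl ?v_ge0.
  by rewrite /u; field; rewrite gt_eqF.
rewrite gerDl; apply/ler_addgt0Pr => e e0; rewrite add0r.
pose t := Num.min 1 (e / (Q + 1)).
have Q10 : 0 < Q + 1 by rewrite ltr_wpDl.
apply: le_trans (key t _) _.
  by rewrite lt_min ltr01 divr_gt0//= ge_min lexx.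
apply: (@le_trans _ _ (e / (Q + 1) * Q)).
  by rewrite ler_wpM2r// ge_min lexx orbT.
by rewrite mulrAC ler_pdivrMr// ler_wpM2l ?(ltW e0)// lerDl.
Qed.

Lemma sum_scale_gt0 (b : C -> R) : (forall g, 0 < b g) ->
  forall x, 0 < (\sum_(g <- D) b g *: g) x.
Proof.
move=> b0 x; rewrite cts_sumE.
have D1x : \sum_(g <- D) g x = 1 by rewrite -cts_sumE PD.2.
rewrite lt_neqAle; apply/andP; split; last first.
  by rewrite big_seq sumr_ge0// => g gD;
    rewrite ?ctsE mulr_ge0 ?(ltW (b0 g)) ?D_ge0.
apply/eqP => /esym H.
have : \sum_(g <- D) g x = 0.
  rewrite big_seq big1// => g gD; apply/eqP; rewrite eq_le D_ge0// andbT.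
  have : b g * g x <= 0.
    rewrite -[leRHS]H (big_fsetD1 g gD)/= lerDl big_seq sumr_ge0// => h.
    by rewrite in_fsetD1 => /andP[_ hD];
      rewrite ?ctsE mulr_ge0 ?(ltW (b0 h)) ?D_ge0.
  by rewrite pmulr_rle0.
by rewrite D1x => /eqP; rewrite oner_eq0.
Qed.

(** Pointwise concavity of ln with the weights [g x], proved by the tangent line at their weighted
    mean [s]. *)
Let ln_concave (b : C -> R) (b0 : forall g, 0 < b g) :
  \sum_(g <- D) mu g * ln (b g) <= mu (cln (sum_scale_gt0 b0)).
Proof.
have -> : \sum_(g <- D) mu g * ln (b g) = mu (\sum_(g <- D) ln (b g) *: g).
  rewrite (state_sum mu); apply: eq_bigr => g _.
  by rewrite (stateZ mu) mulrC.
apply: (state_le smu) => x; rewrite -[leRHS]/(ln ((\sum_(g <- D) b g *: g) x)).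
have s0 := sum_scale_gt0 b0 x; move: s0.
have D1x : \sum_(g <- D) g x = 1 by rewrite -cts_sumE PD.2.
set s := (\sum_(g <- D) b g *: g) x => s0.
have sE : s = \sum_(g <- D) b g * g x by rewrite /s cts_sumE.
rewrite cts_sumE.
apply: (@le_trans _ _ (\sum_(g <- D) (ln s + (b g / s - 1)) * g x)).
  rewrite big_seq [leRHS]big_seq; apply: ler_sum => g gD.
  rewrite ctsE ler_wpM2r ?D_ge0// -lerBlDl -ln_div ?posrE//.
  rewrite -[b g / s in leLHS](subrKC 1); apply: le_ln1Dx.
  have : 0 < b g / s by rewrite divr_gt0.
  lra.
have -> : \sum_(g <- D) (ln s + (b g / s - 1)) * g x =
    (ln s - 1) * \sum_(g <- D) g x + s^-1 * \sum_(g <- D) b g * g x.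
  by rewrite !mulr_sumr -big_split/=; apply: eq_bigr => g _; ring.
by rewrite -sE D1x mulVf ?gt_eqF// mulr1 subrK.
Qed.

Variable c : R.
Hypothesis cP : forall (Psi : C) (Psi0 : forall x, 0 < Psi x),
  0 < unif_norm (B Psi) /\ c + mu (cln Psi0) <= ln (unif_norm (B Psi)).

Let E := \sum_(g <- D) mu g * ln (mu g).

(** The hypothesis [cP] is tested on the combination of the [g] with coefficients [b g]. Optimality
    of [m0] against Dirac states bounds its image under [B] by [1 + h * K], and concavity of ln
    bounds mu(ln Psi) from below. *)
Let regularized d : 0 < d -> exists2 m, states m & c + E <= F d m.
Proof.
move=> d0; have [m0 sm0 m0max] := F_max d0; exists m0 => //.
have opt := F_optimality d0 sm0 m0max.
have K0 := unif_norm_ge0 compX (B 1); set K := unif_norm (B 1) in K0.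
have den0 g : g \in D -> 0 < v m0 g + d by move=> gD; rewrite ltr_wpDl ?v_ge0.
apply/ler_addgt0Pr => e e0; pose h := e / (K + 1).
have K10 : 0 < K + 1 by rewrite ltr_wpDl.
have h0 : 0 < h by rewrite divr_gt0.
have hK : h * K <= e.
  by rewrite /h mulrAC ler_pdivrMr// ler_wpM2l ?(ltW e0)// lerDl.
(* The summand [h] keeps the coefficient positive when [mu g = 0]; the value 1 off [D] only makes
   [b] positive everywhere. *)
pose b (g : C) := if g \in D then mu g / (v m0 g + d) + h else 1.
have b0 g : 0 < b g.
  rewrite /b; case: ifPn => // gD.
  by rewrite ltr_wpDl// divr_ge0 ?p_ge0// ltW// den0.
have [N0 cN] := cP (sum_scale_gt0 b0).
have Nle : unif_norm (B (\sum_(g <- D) b g *: g)) <= 1 + h * K.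
  apply: unif_norm_le => // x; rewrite ger0_norm; last first.
    by apply: Bpos => y; exact/ltW/sum_scale_gt0.
  have sx := dirac_stateP R x.
  have -> : B (\sum_(g <- D) b g *: g) x =
      \sum_(g <- D) b g * v (dirac_state R x) g.
    rewrite raddf_sum cts_sumE; apply: eq_bigr => g _.
    by rewrite -[LHS]/(B (b g *: g) x) linearZ.
  apply: (@le_trans _ _ (\sum_(g <- D) (mu g * ((v (dirac_state R x) g + d) /
      (v m0 g + d)) + h * v (dirac_state R x) g))).
    rewrite big_seq [leRHS]big_seq; apply: ler_sum => g gD.
    rewrite /b gD mulrDl lerD2r -mulrA ler_wpM2l ?p_ge0// mulrC.
    by rewrite ler_wpM2r ?invr_ge0 ?(ltW (den0 g gD))// lerDl ltW.
  rewrite big_split; apply: lerD; first exact: opt.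
  rewrite -mulr_sumr ler_wpM2l ?(ltW h0)//.
  have -> : \sum_(g <- D) v (dirac_state R x) g = B 1 x.
    by rewrite -PD.2 raddf_sum cts_sumE.
  exact: le_trans (ler_norm _) (le_unif_norm compX _ x).
have lnN : ln (unif_norm (B (\sum_(g <- D) b g *: g))) <= e.
  apply: le_trans hK; apply: (@le_trans _ _ (ln (1 + h * K))).
    by rewrite ler_ln ?posrE// ltr_pwDl// mulr_ge0 ?(ltW h0).
  by apply: le_ln1Dx; rewrite (lt_le_trans (ltrN10 R))// mulr_ge0 ?(ltW h0).
have cb : c + \sum_(g <- D) mu g * ln (b g) <= e.
  by apply: le_trans lnN; apply: le_trans cN; rewrite lerD2l ln_concave.
suff : E - F d m0 <= \sum_(g <- D) mu g * ln (b g).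
  by move: cb; move: (\sum_(g <- D) _) (F d m0) E => *; lra.
rewrite /E /F -sumrB big_seq [leRHS]big_seq; apply: ler_sum => g gD.
rewrite -mulrBr; have [->|p0] := eqVneq (mu g) 0; first by rewrite !mul0r.
have {}p0 : 0 < mu g by rewrite lt_neqAle eq_sym p0 p_ge0.
rewrite ler_pM2l// -ln_div ?posrE ?den0// ler_ln ?posrE ?divr_gt0 ?den0//.
by rewrite /b gD lerDl ltW.
Qed.

(** An ultralimit of the maximizers for 1/(n+1). [F] increases with [d], so each fixed [d] inherits
    the bound from all large [n]. *)
Let unregularized : exists2 m, states m & forall d, 0 < d -> c + E <= F d m.
Proof.
have d0 n : (0 : R) < n.+1%:R^-1 by rewrite invr_gt0 ltr0n.
have /choice[m_ m_P] n : exists m, states m /\ c + E <= F n.+1%:R^-1 m.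
  by have [m sm H] := regularized (d0 n); exists m.
have [U UU ooU] := ultrafilter_ex.
have [m sm mcvg] := state_ultra_cvg compX UU (fun n => (m_P n).1).
exists m => // d dgt0.
apply: (@cvgr_to_ge nat U _ R (fun n => F d (m_ n))); first exact: cvg_F.
apply: ooU; exists (Num.trunc d^-1) => // n /= kn.
apply: (le_trans (m_P n).2); rewrite /F big_seq [leRHS]big_seq.
apply: ler_sum => g gD; have vg := v_ge0 (m_P n).1 gD.
rewrite ler_wpM2l ?p_ge0// ler_ln ?posrE ?ltr_wpDl// lerD2l.
rewrite -[leRHS]invrK lef_pV2 ?posrE ?ltr0n ?invr_gt0// ltW//.
by apply: lt_le_trans (truncnS_gt _) _; rewrite ler_nat ltnS.
Qed.

Lemma entropy_sum_ge : exists2 m, states m &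
  (c%:E <= entropy_sum D (mu : C -> R) (fun g => m (B g)))%E.
Proof.
have [m sm mP] := unregularized; exists m => //.
have vpos g : g \in D -> mu g != 0 -> 0 < v m g.
  move=> gD p0; rewrite lt_neqAle v_ge0// andbT eq_sym; apply/eqP => vg0.
  have {}p0 : 0 < mu g by rewrite lt_neqAle eq_sym p0 p_ge0.
  pose M := \sum_(h <- (D `\ g)%fset) mu h * ln (unif_norm (B h) + 1).
  (* This [d] is at most 1, so the other terms are at most [M], and is small enough that mu(g) ln d
     + M < c + E. *)
  pose d := expR (Num.min 0 ((c + E - M) / mu g - 1)).
  have d0 : 0 < d by exact: expR_gt0.
  have d1 : d <= 1 by rewrite -expR0 ler_expR ge_min lexx.
  have := mP d d0; rewrite /F (big_fsetD1 g gD)/= vg0 add0r expRK.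
  apply/negP; rewrite -ltNge.
  apply: (@le_lt_trans _ _ (mu g * ((c + E - M) / mu g - 1) + M)).
    apply: lerD; first by rewrite ler_pM2l// ge_min lexx orbT.
    rewrite /M big_seq [leRHS]big_seq; apply: ler_sum => h.
    rewrite in_fsetD1 => /andP[_ hD]; rewrite ler_wpM2l ?p_ge0//.
    rewrite ler_ln ?posrE ?ltr_wpDl ?v_ge0 ?unif_norm_ge0//.
    by rewrite lerD// (le_trans (ler_norm _))// (state_norm compX sm).
  by rewrite mulrBr mulr1 mulrC divfK ?gt_eqF//; lra.
rewrite entropy_sum_EFin// lee_fin.
have -> : \sum_(g <- D) mu g * ln (m (B g) / mu g) =
    \sum_(g <- D) mu g * ln (v m g) - E.
  rewrite /E -sumrB big_seq [RHS]big_seq; apply: eq_bigr => g gD.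
  have [->|p0] := eqVneq (mu g) 0; first by rewrite !mul0r subrr.
  by rewrite -mulrBr ln_div ?posrE ?vpos// lt_neqAle eq_sym p0 p_ge0.
rewrite lerBrDr; pose Q := \sum_(g <- D) mu g / v m g.
have Q0 : 0 <= Q.
  by rewrite /Q big_seq sumr_ge0// => g gD; rewrite divr_ge0 ?p_ge0 ?v_ge0.
(* Since ln (v + d) <= ln v + d / v, removing [d] costs at most [d * Q <= e]. *)
apply/ler_addgt0Pr => e e0; pose d := e / (Q + 1).
have Q10 : 0 < Q + 1 by rewrite ltr_wpDl.
have d0 : 0 < d by rewrite divr_gt0.
apply: (le_trans (mP d d0)).
apply: (@le_trans _ _ (\sum_(g <- D) mu g * ln (v m g) + d * Q)); last first.
  by rewrite lerD2l /d mulrAC ler_pdivrMr// ler_wpM2l ?(ltW e0)// lerDl.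
rewrite /F /Q mulr_sumr -big_split/= big_seq [leRHS]big_seq.
apply: ler_sum => g gD; have [->|p0] := eqVneq (mu g) 0.
  by rewrite !mul0r mulr0 addr0.
have vg := vpos g gD p0.
have -> : mu g * ln (v m g) + d * (mu g / v m g) =
  mu g * (ln (v m g) + d / v m g) by ring.
rewrite ler_wpM2l ?p_ge0//.
have -> : v m g + d = v m g * (1 + d / v m g) by field; rewrite gt_eqF.
have dv : 0 < d / v m g by rewrite divr_gt0.
rewrite lnM ?posrE ?addr_gt0// lerD2l; apply: le_ln1Dx.
by apply: lt_trans dv; exact: ltrN10.
Qed.

End minimax.

(** * The variational principle and its attainment *)

Theorem theorem5p8 (R : realType) (X : ptopologicalType)
    (hausX : hausdorff_space X) (compX : compact [set: X])
    (alpha : continuousType X X)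
    (A : {linear continuousType X R -> continuousType X R})
    (transA : is_transfer_operator alpha A)
    (psi : continuousType X R) (psi_ge0 : nonneg psi) :
  (exists2 mu, invariant_states alpha mu &
    log_spectral_radius (weighted A psi)
      = integral_ln psi mu + t_entropy A mu)%E /\
  (forall mu, invariant_states alpha mu ->
    integral_ln psi mu + t_entropy A mu
      <= log_spectral_radius (weighted A psi))%E.
Proof.
have upper := variational_le hausX compX transA psi_ge0.
split; last exact: upper.
set l := log_spectral_radius _.
have lE : l = ereal_inf [set ((n%:R^-1)%:E *
    lne (unif_norm (iter n A (bprod alpha n psi)))%:E)%E
    | n in [set n | (0 < n)%N]].
  exact: spectral_radius_weighted.
suff [mu imu H] : exists2 mu, invariant_states alpha mu &
    (l <= integral_ln psi mu + t_entropy A mu)%E.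
  by exists mu => //; apply/eqP; rewrite eq_le H upper.
have l_le n : (0 < n)%N -> (l <= (n%:R^-1)%:E *
    lne (unif_norm (iter n A (bprod alpha n psi)))%:E)%E.
  by move=> n0; rewrite lE; apply: ereal_inf_lbound; exists n.
(* The value +oo is excluded at n = 1; for -oo any invariant state attains the maximum, and one
   exists as a limit of Dirac averages. *)
case E : l l_le => [c| |] l_le; last 2 first.
- have := l_le 1%N isT; rewrite leye_eq invr1 mul1e.
  set b := unif_norm _.
  by have [b0|b0] := leP b 0; [rewrite le0_lneNy ?lee_fin|rewrite lne_EFin].
- have [mu imu _] := invariant_limit compX alpha
    (fun _ : nat => dirac_stateP R (point : X)).
  by exists mu => //; rewrite leNye.
have a_gt0 n : 0 < unif_norm (iter n A (bprod alpha n psi)).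
  case: n => [|n].
    rewrite /bprod big_ord0/=; apply: lt_le_trans (le_unif_norm compX _ point).
    by rewrite normr1.
  rewrite ltNge; apply/negP => an0; have := l_le n.+1 isT.
  rewrite le0_lneNy ?lee_fin// mulr_infty gtr0_sg ?invr_gt0 ?ltr0n// mul1e.
  by rewrite leeNy_eq.
have ca n : (0 < n)%N ->
    n%:R * c <= ln (unif_norm (iter n A (bprod alpha n psi))).
  move=> n0; have := l_le n n0; rewrite lne_EFin// -EFinM lee_fin.
  by rewrite mulrC ler_pdivlMr ?ltr0n// mulrC.
have [mu imu muP] := equilibrium_state_ex compX transA psi_ge0 a_gt0 ca.
exists mu => //; have [smu _] := imu.
(* For each [N] and each partition, the minimax state bounds tau_N(mu, D) from below by N (c - mu(ln
   (psi + d))). *)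
have tau_ge d (d0 : 0 < d) :
    ((c - mu (cln (add_cst_gt0 psi_ge0 d0)))%:E <= t_entropy A mu)%E.
  apply: le_ereal_inf_tmp => _ [N N0 <-].
  have NR0 : (0 : R) < N%:R by rewrite ltr0n.
  set c' := c - _; suff H : ((N%:R * c')%:E <= tau_n A N mu)%E.
    have Ninv : (0 <= (N%:R^-1 : R)%:E)%E by rewrite lee_fin invr_ge0 ltW.
    apply: le_trans (lee_wpmul2l Ninv H).
    by rewrite -EFinM mulKf ?gt_eqF.
  apply: le_ereal_inf_tmp => _ [D PD <-].
  have [m sm Hm] := entropy_sum_ge compX (lin_iter_pos N (transfer_pos transA))
    smu PD (fun Psi Psi0 => muP N Psi Psi0 d d0 N0).
  by apply: le_trans Hm _; apply: ereal_sup_ubound; exists m.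
have ge_c := @integral_ln_ge R X hausX compX mu smu psi psi_ge0.
(* tau(mu) is finite: the Jensen bound for the unit function at n = 1 excludes +oo, and [tau_ge] at
   d = 1 excludes -oo. *)
case T : (t_entropy A mu) tau_ge => [t| |] tau_ge; last 2 first.
- have one_gt0 : forall x, 0 < (1 : continuousType X R) x by move=> x;
  rewrite ctsE.
  have tau_le : (t_entropy A mu <= tau_n A 1 mu)%E.
    by apply: ereal_inf_lbound; exists 1%N => //; rewrite invr1 mul1e.
  have := tau_n_le compX transA smu 1 one_gt0.
  move: tau_le; rewrite T leye_eq => /eqP ->; rewrite addey// leye_eq.
  set b := unif_norm _.
  by have [b0|b0] := leP b 0; [rewrite le0_lneNy ?lee_fin|rewrite lne_EFin].
- by have := tau_ge 1 ltr01; rewrite leeNy_eq.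
have ct d (d0 : 0 < d) : c - t <= mu (cln (add_cst_gt0 psi_ge0 d0)).
  by have := tau_ge d d0; rewrite lee_fin; lra.
by rewrite -leeBlDr// -EFinB; exact: ge_c ct.
Qed.
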